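(* Let $(X,d)$ be a compact metric space with topological dimension $\dim(X)>1$ and let $\phi$ be a regular expansive continuous flow on $X$. If $K\subset X$ is a compact, $\phi$-invariant subset of topological dimension one, then there is a minimal subset of $X$ disjoint from $K$.
   Context: A continuous flow is a continuous map $\phi\colon\mathbb{R}\times X\to X$, $\phi_t=\phi(t,\cdot)$, with $\phi_0=\mathrm{id}$, $\phi_{t+s}=\phi_s\circ\phi_t$; regular means no fixed points. $K$ invariant means $\phi_t(K)=K$ for all $t$. A minimal subset is a nonempty compact invariant set with no nonempty proper compact invariant subset. Let $Rep$ be the set of increasing homeomorphisms $h\colon\mathbb{R}\to\mathbb{R}$ with $h(0)=0$. $\phi$ is expansive if for every $\varepsilon>0$ there is $\delta>0$ such that whenever $x,y\in X$, $h\in Rep$ and $d(\phi_t(x),\phi_{h(t)}(y))\le\delta$ for all $t\in\mathbb{R}$, then $y\in\phi_{[-\varepsilon,\varepsilon]}(x)$. *)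

(* Defs.v *)
From HB Require Import structures.
From mathcomp Require Import all_boot all_order all_algebra.
From mathcomp Require Import all_classical all_reals all_analysis.
Set Implicit Arguments. Unset Strict Implicit. Unset Printing Implicit Defensive.
Import Order.TTheory GRing.Theory Num.Theory.
Import numFieldNormedType.Exports.
Local Open Scope classical_set_scope.
Local Open Scope ring_scope.

Section Defs.
Context {R : realType} {X : metricType R}.

Definition is_flow (phi : R -> X -> X) : Prop :=
  [/\ (forall x, phi 0 x = x),
      (forall t s x, phi (t + s) x = phi s (phi t x)) &
      continuous (fun p : R * X => phi p.1 p.2)].

Definition regular_flow (phi : R -> X -> X) : Prop :=
  forall x, ~ (forall t, phi t x = x).

Definition flow_invariant (phi : R -> X -> X) (K : set X) : Prop :=
  forall t, phi t @` K = K.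

Definition minimal_subset (phi : R -> X -> X) (M : set X) : Prop :=
  [/\ M !=set0, compact M, flow_invariant phi M &
      forall N, N `<=` M -> N !=set0 -> compact N -> flow_invariant phi N -> N = M].

Definition Rep (h : R -> R) : Prop :=
  [/\ exists g : R -> R, [/\ cancel h g, cancel g h & continuous g],
      continuous h, {homo h : x y / x < y} & h 0 = 0].

Definition expansive (phi : R -> X -> X) : Prop :=
  forall eps : R, 0 < eps -> exists2 delta : R, 0 < delta &
    forall (x y : X) (h : R -> R), Rep h ->
      (forall t, mdist (phi t x) (phi (h t) y) <= delta) ->
      exists2 s : R, `|s| <= eps & y = phi s x.

Definition cover_dim_le (A : set X) (n : nat) : Prop :=
  forall (k : nat) (U : 'I_k -> set X), (forall i, open (U i)) ->
    A `<=` \bigcup_i U i ->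
    exists (m : nat) (V : 'I_m -> set X),
      [/\ (forall j, open (V j)), A `<=` \bigcup_j V j,
          (forall j, exists i, V j `<=` U i) &
          (forall x, A x -> (#|[set j : 'I_m | `[< V j x >] ]| <= n.+1)%N)].

End Defs.

(* Main.v *)
(** A phase function [Gam] provides, continuously in x, a local cross section
    {y near x : Gam x y = 0} through every point x, and [step s], s = 1 or -1,
    moves a pair (x, y) with y on the section at x to time s along the orbit of x,
    correcting y back onto the section at phi s x.  On pairs at small distance,
    [step 1] and [step (-1)] are mutually inverse and expansivity says that a pair
    staying close under all iterates is diagonal; they behave like an expansive
    homeomorphism acting on the fibres.

    If dim X > 1, the sections contain nontrivial continua of arbitrarily small
    diameter: otherwise they are totally disconnected and X is a finite union of
    flow boxes of dimension at most 1.  As in Mañé's theorem, a limit of large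
    iterates of such continua is a nondegenerate continuum D in the section at
    some x that stays close to x under all iterates of [step s], for one of the
    signs s.  If dim K <= 1, continua of definite size in a section are not
    contained in a thin neighbourhood of K: a nontrivial continuum C in K transverse
    to the flow would yield a strip C x [0,a] in K, contradicting Lebesgue's covering
    theorem.  So one can cut D near a point p outside a neighbourhood of K, keep
    a small continuum through p, and let it grow under [step (-s)], which takes a
    bounded time, to a continuum of the same kind.  Repeating this gives orbits
    that leave the neighbourhood of K with bounded gaps, and in the limit a compact
    invariant set disjoint from K.

    Continua are represented by closed well-chained sets, and compactness is used
    in the form of limits, along one free ultrafilter on nat, of sequences of
    counterexamples. *)
Require Import Defs.
From HB Require Import structures.
From mathcomp Require Import all_boot all_order all_algebra.
From mathcomp Require Import all_classical all_reals all_analysis.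
From mathcomp Require Import ring lra zify.
Set Implicit Arguments. Unset Strict Implicit. Unset Printing Implicit Defensive.
Import Order.TTheory GRing.Theory Num.Theory.
Import numFieldNormedType.Exports.
Local Open Scope classical_set_scope.
Local Open Scope ring_scope.

(** * Limits along a free ultrafilter on nat *)

Lemma nat_ultrafilter_exists :
  exists F : set_system nat, UltraFilter F /\ eventually `<=` F.
Proof. exact: ultraFilterLemma. Qed.

(** One fixed ultrafilter replaces the extraction of subsequences: every sequence in a compact set
    converges along it. *)
Definition uoo : set_system nat := sval (cid nat_ultrafilter_exists).

#[global] Instance uoo_ultra : UltraFilter uoo.
Proof. by rewrite /uoo; case: cid => F []. Qed.

Lemma uoo_eventually : eventually `<=` uoo.
Proof. by rewrite /uoo; case: cid => F []. Qed.

Lemma uoo_ge (N : nat) : \forall n \near uoo, (N <= n)%N.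
Proof. by apply: uoo_eventually; exact: nbhs_infty_ge. Qed.

Lemma uooP (P : nat -> Prop) :
  (\forall n \near uoo, P n) \/ (\forall n \near uoo, ~ P n).
Proof. exact: (in_ultra_setVsetC P uoo_ultra). Qed.

Lemma uoo_harmonic (R : realType) : (harmonic : nat -> R) @ uoo --> (0 : R).
Proof.
by apply: cvg_trans (@cvg_harmonic R); apply: cvg_app; exact: uoo_eventually.
Qed.

Lemma uoo_harmonic_lt (R : realType) (e : R) : 0 < e ->
  \forall n \near uoo, harmonic n < e.
Proof.
move=> e0; have /cvgrPdist_lt/(_ _ e0) := @uoo_harmonic R.
by apply: filterS => n; rewrite sub0r normrN ger0_norm// harmonic_ge0.
Qed.

Section metric_ultralimits.
Context {R : realType} {X : metricType R}.
Implicit Types (x y : nat -> X) (A : set X).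
Notation d := (@mdist R X).

(** A cluster point along an ultrafilter is a limit, since each ball or its complement belongs to
    the ultrafilter. *)
Lemma ucvg_compact A : compact A -> forall x, (forall n, A (x n)) ->
  exists2 l, A l & x @ uoo --> l.
Proof.
move=> cA x Ax.
have [] := cA (x @ uoo); first by apply: (filterE (F := uoo)) => n; exact: Ax.
move=> l [Al xl]; exists l => //.
apply/metricType_numDomainType.cvgrPdist_lt => e e0.
case: (uooP (fun n => d l (x n) < e)) => // H.
have := xl [set y | ~ (d l y < e)] (ball l e) H (nbhsx_ballx _ _ e0).
by rewrite ballEmdist => -[y []].
Qed.

Lemma ucvg_real (u : nat -> R) M : (forall n, `|u n| <= M) ->
  exists2 l, `|l| <= M & u @ uoo --> l.
Proof.
move=> uM; have cA : compact `[-M, M] by exact: segment_compact.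
have [] := cA (u @ uoo).
  by apply: (filterE (F := uoo)) => n; rewrite /= in_itv /= -ler_norml uM.
move=> l [Al xl]; exists l; first by rewrite /= in_itv/= in Al; rewrite ler_norml.
apply/cvgrPdist_lt => e e0.
case: (uooP (fun n => `|l - u n| < e)) => // H.
by have := xl [set y | ~ (`|l - y| < e)] (ball l e) H (nbhsx_ballx _ _ e0) => -[y []].
Qed.

Lemma mdist_cvg {T} {F : set_system T} {FF : Filter F} (f g : T -> X) a b :
  f @ F --> a -> g @ F --> b -> (fun t => d (f t) (g t)) @ F --> d a b.
Proof.
move=> fa gb; apply/cvgrPdist_le => e e0.
have e2 : 0 < e / 2 by rewrite divr_gt0.
near=> t.
have h1 : d a (f t) <= e / 2 by near: t; apply: metricType_numDomainType.cvgr_dist_le.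
have h2 : d b (g t) <= e / 2 by near: t; apply: metricType_numDomainType.cvgr_dist_le.
have t1 := metric_triangle a (f t) b; have t2 := metric_triangle (f t) (g t) b.
have t3 := metric_triangle (f t) a (g t); have t4 := metric_triangle a b (g t).
move: t1 t2 t3 t4 h1 h2; rewrite (metric_sym (g t) b) (metric_sym (f t) a).
by move=> *; rewrite ler_norml; lra.
Unshelve. all: by end_near. Qed.

Lemma ucvg_unique x (a b : X) : x @ uoo --> a -> x @ uoo --> b -> a = b.
Proof. by apply: cvg_unique; exact: metric_hausdorff. Qed.

Lemma ucvg_le (u v : nat -> R) (a b : R) : u @ uoo --> a -> v @ uoo --> b ->
  (\forall n \near uoo, u n <= v n) -> a <= b.
Proof. exact: ler_cvg_to. Qed.

Lemma ucvg_le_cst (u : nat -> R) (a b : R) : u @ uoo --> a ->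
  (\forall n \near uoo, u n <= b) -> a <= b.
Proof. exact: cvgr_to_le. Qed.

Lemma ucvg_ge_cst (u : nat -> R) (a b : R) : u @ uoo --> a ->
  (\forall n \near uoo, b <= u n) -> b <= a.
Proof. exact: cvgr_to_ge. Qed.

Lemma ucvg_near_cst (u : nat -> R) (a : R) : (\forall n \near uoo, u n = a) ->
  u @ uoo --> a.
Proof.
move=> ua; apply/cvgrPdist_lt => e e0; apply: filterS ua => n ->.
by rewrite subrr normr0.
Qed.

Lemma ucvg0 (u : nat -> R) : (\forall n \near uoo, `|u n| <= harmonic n) ->
  u @ uoo --> (0 : R).
Proof.
move=> H; apply/cvgrPdist_lt => e e0; near=> n.
rewrite sub0r normrN; apply: (@le_lt_trans _ _ (harmonic n)); first by near: n.
by near: n; exact: uoo_harmonic_lt.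
Unshelve. all: by end_near. Qed.

Lemma ucvg_mdist0 x y (a b : X) : x @ uoo --> a -> y @ uoo --> b ->
  (\forall n \near uoo, d (x n) (y n) <= harmonic n) -> a = b.
Proof.
move=> xa yb H; apply: mdist_positivity; apply/eqP; rewrite eq_le mdist_ge0 andbT.
exact: (ucvg_le (mdist_cvg xa yb) (@uoo_harmonic R)).
Qed.

Lemma ucvg_mdist x (a : X) : (fun n => d a (x n)) @ uoo --> (0 : R) -> x @ uoo --> a.
Proof.
move=> H; apply/metricType_numDomainType.cvgrPdist_lt => e e0.
move/cvgrPdist_lt : H => /(_ _ e0); apply: filterS => n.
by rewrite sub0r normrN ger0_norm // mdist_ge0.
Qed.

Lemma ucvg_dist_lt x (a : X) (e : R) : x @ uoo --> a -> 0 < e ->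
  \forall n \near uoo, d a (x n) < e.
Proof. by move=> xa e0; exact: metricType_numDomainType.cvgr_dist_lt. Qed.

Lemma closed_ucvg A x (l : X) : closed A -> (\forall n \near uoo, A (x n)) ->
  x @ uoo --> l -> A l.
Proof. by move=> cA Ax xl; exact: (closed_cvg _ cA Ax l xl). Qed.

Lemma ucvg_closed A : (forall x (l : X), (forall n, A (x n)) -> x @ uoo --> l -> A l) ->
  closed A.
Proof.
move=> H l Al.
have /choice[x xP] : forall n : nat, exists z, A z /\ d l z < harmonic n.
  move=> n; have [y []] := Al _ (nbhsx_ballx l (harmonic n) (harmonic_gt0 n)).
  by rewrite ballEmdist => Ay ly; exists y.
apply: (H x); first by move=> n; case: (xP n).
apply: ucvg_mdist; apply: ucvg0; apply: nearW => n.
by rewrite ger0_norm ?mdist_ge0// ltW//; case: (xP n).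
Qed.

End metric_ultralimits.

(** * Well-chained sets *)

(** Uniform positive constants are mostly obtained this way: if [P] failed at every [harmonic n],
    the counterexamples would form a sequence with a contradictory limit. *)
Lemma ex_pos_harmonic (R : realType) (P : R -> Prop) :
  ~ (forall n : nat, ~ P (harmonic n)) -> exists2 e : R, 0 < e & P e.
Proof.
move=> H; apply: contrapT => H'; apply: H => n Pn; apply: H'.
by exists (harmonic n) => //; exact: harmonic_gt0.
Qed.

Section chains.
Context {R : realType} {X : metricType R}.
Implicit Types (A C D E : set X).
Notation d := (@mdist R X).

(* There is a chain from p to y in D with jumps at most eta; this second-order
   form makes every argument on chains a choice of A. *)
Definition chained D (eta : R) (p y : X) : Prop :=
  forall A, A p -> (forall a b, A a -> D b -> d a b <= eta -> A b) -> A y.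

Lemma chained_refl D eta p : chained D eta p p.
Proof. by move=> A. Qed.

Lemma chained_step D eta p a b :
  chained D eta p a -> D b -> d a b <= eta -> chained D eta p b.
Proof. by move=> pa Db ab A Ap Ac; apply: (Ac _ _ _ Db ab); exact: pa. Qed.

Lemma chained_trans D eta p a b :
  chained D eta p a -> chained D eta a b -> chained D eta p b.
Proof. by move=> pa ab A Ap Ac; apply: ab => //; exact: pa. Qed.

Lemma chained_mem D eta p y : D p -> chained D eta p y -> D y.
Proof. by move=> Dp py; exact: (py D). Qed.

Lemma chained_sym D eta p y : D p -> chained D eta p y -> chained D eta y p.
Proof.
move=> Dp py A Ay Ac; apply: contrapT => nAp.
have [] := py [set z | D z /\ ~ A z] => //=.
move=> a b [Da nAa] Db ab; split=> // Ab; apply: nAa.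
by apply: (Ac _ _ Ab Da); rewrite metric_sym.
Qed.

(** In a compact space these are the subcontinua through the base point [p]. *)
Definition well_chained (p : X) D : Prop :=
  [/\ closed D, D p & forall eta : R, 0 < eta -> forall y, D y -> chained D eta p y].

Lemma well_chained_base p q D : well_chained p D -> D q -> well_chained q D.
Proof.
move=> [cD Dp H] Dq; split => // eta e0 y Dy.
by apply: chained_trans (chained_sym Dp (H _ e0 _ Dq)) (H _ e0 _ Dy).
Qed.

Definition ulimset (C : nat -> set X) : set X :=
  [set x | forall e : R, 0 < e -> \forall n \near uoo, exists2 y, C n y & d x y < e].

Lemma ulimset_mem (C : nat -> set X) (x : nat -> X) (l : X) : (\forall n \near uoo, C n (x n)) ->
  x @ uoo --> l -> ulimset C l.
Proof.
move=> Cx xl e e0; near=> n; exists (x n); first by near: n.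
by near: n; exact: metricType_numDomainType.cvgr_dist_lt.
Unshelve. all: by end_near. Qed.

(** The [C n] need not be closed, so nearest points may not exist; points within [harmonic n] of the
    infimum distance are chosen instead. *)
Lemma ulimset_seq (C : nat -> set X) (l : X) : (forall n, C n !=set0) -> ulimset C l ->
  exists2 x : nat -> X, (forall n, C n (x n)) & x @ uoo --> l.
Proof.
move=> C0 Ll.
have /choice[x xP] : forall n, exists y, C n y /\
    forall z, C n z -> d l y <= d l z + harmonic n.
  move=> n; pose S := [set d l z | z in C n].
  have hS : has_inf S.
    split; first by have [z Cz] := C0 n; exists (d l z), z.
    by exists 0 => _ [z _ <-]; exact: mdist_ge0.
  have [_ [y Cy <-] yS] := inf_adherent (harmonic_gt0 n) hS.
  exists y; split => // z Cz; apply: (le_trans (ltW yS)); rewrite lerD2r.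
  by apply: ge_inf; [exact: hS.2 | exists z].
exists x => [n|]; first by case: (xP n).
apply/metricType_numDomainType.cvgrPdist_lt => e e0.
have e2 : 0 < e / 2 by rewrite divr_gt0.
near=> n; have [z Cz lz] : exists2 z, C n z & d l z < e / 2.
  by near: n; exact: Ll.
have [_ /(_ _ Cz) h] := xP n; apply: (le_lt_trans h).
have : harmonic n < e / 2 by near: n; exact: uoo_harmonic_lt.
by move=> ?; lra.
Unshelve. all: by end_near. Qed.

Lemma closed_ulimset (C : nat -> set X) : closed (ulimset C).
Proof.
move=> x Lx e e0; have e2 : 0 < e / 2 by rewrite divr_gt0.
have [y [Ly]] := Lx _ (nbhsx_ballx x _ e2); rewrite ballEmdist /= => xy.
have := Ly _ e2; apply: filterS => n [z Cz yz]; exists z => //.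
by have := metric_triangle x y z; lra.
Qed.

Hypothesis cX : compact [set: X].

Lemma ucvgX (x : nat -> X) : exists l : X, x @ uoo --> l.
Proof. by have [//|l _ xl] := ucvg_compact cX (x := x); exists l. Qed.

(** By compactness [C n] lies in a small neighbourhood of the limit set for most [n], so a fine
    chain in [C n] is shadowed by a chain in the limit set. *)
Lemma well_chained_ulimset (C : nat -> set X) (p : nat -> X) (eta : nat -> R) (l : X) :
  (forall n, C n (p n)) -> p @ uoo --> l -> eta @ uoo --> (0 : R) ->
  (forall n y, C n y -> chained (C n) (eta n) (p n) y) ->
  well_chained l (ulimset C).
Proof.
move=> Cp pl eta0 CC; split; first exact: closed_ulimset.
  by apply: ulimset_mem pl; apply: nearW.
move=> e e0 y Ly; have e3 : 0 < e / 3 by rewrite divr_gt0.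
have L3 : \forall n \near uoo, forall z, C n z -> exists2 w, ulimset C w & d z w < e / 3.
  case: (uooP (fun n => forall z, C n z -> exists2 w, ulimset C w & d z w < e / 3)) => //.
  move=> H.
  (* [z n] is a point of [C n] far from the limit set whenever there is one; the ultralimit of such
     points would lie in the limit set. *)
  have /choice[z zP] : forall n, exists z, C n z /\
     ((exists z, C n z /\ ~ exists2 w, ulimset C w & d z w < e / 3) ->
        ~ exists2 w, ulimset C w & d z w < e / 3).
    move=> n; case: (pselect (exists z, C n z /\ ~ exists2 w, ulimset C w & d z w < e / 3)).
      by move=> [z [Cz Hz]]; exists z.
    by move=> H'; exists (p n); split => // /H'.
  have [w zw] := ucvgX z.
  have Lw : ulimset C w by apply: ulimset_mem zw; apply: nearW => n; case: (zP n).
  have [n [/= Hn zwn]] := filter_ex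
    (filterI H (metricType_numDomainType.cvgr_dist_lt zw e3)).
  have [_ []] := zP n.
    apply: contrapT => H'; apply: Hn => z' Cz'; apply: contrapT => H''.
    by apply: H'; exists z'.
  by exists w => //; rewrite metric_sym.
have En : \forall n \near uoo, eta n < e / 3.
  move/cvgrPdist_lt : eta0 => /(_ _ e3); apply: filterS => n.
  by rewrite sub0r normrN; apply: le_lt_trans; exact: ler_norm.
have [n [[L3n En'] [pn [y' Cy' yy']]]] := filter_ex (filterI (filterI L3 En)
  (filterI (metricType_numDomainType.cvgr_dist_lt pl e3) (Ly _ e3))).
move=> A Al Ac.
have [|a b [w [Aw Lw aw]] Cb ab|w [Aw Lw yw]] :=
  CC n y' Cy' [set z | exists w, [/\ A w, ulimset C w & d z w < e / 3]].
- exists l; split => //; last by rewrite metric_sym.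
  by apply: ulimset_mem pl; apply: nearW.
- have [w' Lw' bw'] := L3n _ Cb; exists w'; split => //.
  apply: (Ac _ _ Aw Lw').
  have := metric_triangle w a w'; have := metric_triangle a b w'.
  by rewrite (metric_sym w a); lra.
- apply: (Ac _ _ Aw Ly); have := metric_triangle w y' y.
  by rewrite (metric_sym w y') (metric_sym y' y); lra.
Qed.

Lemma chained_class E eta p z :
  chained E eta p z -> chained (chained E eta p) eta p z.
Proof.
move=> pz A Ap Ac.
have [] := pz [set w | A w /\ chained E eta p w] => //=.
  by split => //; exact: chained_refl.
move=> a b [Aa pa] Eb ab; have pb := chained_step pa Eb ab.
by split => //; exact: (Ac _ _ Aa pb ab).
Qed.

Lemma well_chained_of_chains E (lam : R) : closed E ->
  (forall n : nat, exists a b, [/\ E a, chained E (harmonic n) a b & lam <= d a b]) ->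
  exists p D, [/\ well_chained p D, D `<=` E & exists2 q, D q & lam <= d p q].
Proof.
move=> cE /choice[a /choice[b abP]].
have [p ap] := ucvgX a; have [q bq] := ucvgX b.
pose C n := chained E (harmonic n) (a n).
have CE n : C n `<=` E by move=> z; apply: chained_mem; case: (abP n).
exists p, (ulimset C); split.
- apply: (@well_chained_ulimset C a harmonic) => //.
  + by move=> n; exact: chained_refl.
  + exact: uoo_harmonic.
  + by move=> n y; exact: chained_class.
- move=> z /ulimset_seq[|x Cx xz]; first by move=> n; exists (a n); exact: chained_refl.
  by apply: closed_ucvg cE _ xz; apply: nearW => n; apply: CE.
- exists q; first by apply: ulimset_mem bq; apply: nearW => n; case: (abP n).
  by apply: ucvg_ge_cst (mdist_cvg ap bq) _; apply: nearW => n; case: (abP n).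
Qed.

(** A fine chain from [p] to [y] must leave the ball of radius [rho], so the chain class of [p]
    inside the closed ball comes within one jump of its boundary. The limit of these classes reaches
    distance [rho]. *)
Lemma boundary_bumping p E y (rho : R) : 0 < rho -> well_chained p E -> E y ->
  rho <= d p y -> exists D, [/\ well_chained p D, D `<=` E,
    (forall z, D z -> d p z <= rho) & exists2 z, D z & rho <= d p z].
Proof.
move=> rho0 [cE Ep wE] Ey rhoy.
pose B := E `&` [set z | d p z <= rho].
have cB : closed B.
  apply: ucvg_closed => x l Bx xl; split.
    by apply: closed_ucvg cE _ xl; apply: nearW => n; case: (Bx n).
  by apply: ucvg_le_cst (mdist_cvg (cvg_cst p) xl) _; apply: nearW => n; case: (Bx n).
have Bp : B p by split => //=; rewrite mdistxx ltW.
pose C n := chained B (harmonic n) p.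
have CB n : C n `<=` B by move=> z; exact: chained_mem.
have /choice[z zP] : forall n, exists z, C n z /\ rho - harmonic n <= d p z.
  move=> n; apply: contrapT => H.
  have [] := wE _ (harmonic_gt0 n) _ Ey [set z | C n z /\ d p z < rho - harmonic n].
  - split; first exact: chained_refl.
    rewrite ltNge; apply/negP => h; apply: H.
    by exists p; split => //; exact: chained_refl.
  - move=> a b [Ca ha] Eb ab.
    have pb : d p b <= rho by have := metric_triangle p a b; move: ha ab; lra.
    have Cb : C n b by apply: chained_step Ca _ ab.
    split => //; rewrite ltNge; apply/negP => h; apply: H.
    by exists b.
  - by have := harmonic_gt0 n (R := R); lra.
have [q zq] := ucvgX z.
have LB : ulimset C `<=` B.
  move=> w /ulimset_seq[|x Cx xw]; first by move=> n; exists p; exact: chained_refl.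
  by apply: closed_ucvg cB _ xw; apply: nearW => n; apply: CB.
exists (ulimset C); split.
- apply: (@well_chained_ulimset C (fun=> p) harmonic) => //.
  + by move=> n; exact: chained_refl.
  + exact: cvg_cst.
  + exact: uoo_harmonic.
  + by move=> n w; exact: chained_class.
- by move=> w /LB[].
- by move=> w /LB[].
- exists q; first by apply: ulimset_mem zq; apply: nearW => n; case: (zP n).
  have h : (fun n => rho - harmonic n) @ uoo --> rho - 0.
    by apply: cvgB; [exact: cvg_cst | exact: uoo_harmonic].
  rewrite -(subr0 rho); apply: ucvg_le h (mdist_cvg (cvg_cst p) zq) _.
  by apply: nearW => n; case: (zP n).
Qed.

Definition ucontinuous_on D (f : X -> X) := forall (x : nat -> X) (l : X),
  (forall n, D (x n)) -> x @ uoo --> l -> f \o x @ uoo --> f l.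

(** By compactness [f] is uniformly continuous on [D], so it maps fine chains to fine chains. *)
Lemma well_chained_image p D f : well_chained p D -> ucontinuous_on D f ->
  well_chained (f p) (f @` D).
Proof.
move=> [cD Dp wD] cf; split.
- apply: ucvg_closed => z m Dz zm.
  have /choice[x xP] : forall n, exists w, D w /\ f w = z n.
    by move=> n; have [w Dw fw] := Dz n; exists w.
  have [l xl] := ucvgX x.
  have Dl : D l by apply: closed_ucvg cD _ xl; apply: nearW => n; case: (xP n).
  have fl : z @ uoo --> f l.
    rewrite (_ : z = f \o x); last by apply/funext => n /=; case: (xP n).
    by apply: cf xl => n; case: (xP n).
  by exists l => //; exact: ucvg_unique fl zm.
- by exists p.
- move=> eta eta0 _ [y Dy <-].
  have [e e0 He] : exists2 e : R, 0 < e &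
      forall a b, D a -> D b -> d a b <= e -> d (f a) (f b) <= eta.
    apply: ex_pos_harmonic => H.
    have /choice[a /choice[b abP]] : forall n : nat, exists a b,
        [/\ D a, D b, d a b <= harmonic n & ~ d (f a) (f b) <= eta].
      move=> n; have := H n => /existsNP[a] /existsNP[b].
      by move=> /not_implyP[Da] /not_implyP[Db] /not_implyP[ab h]; exists a, b.
    have [l al] := ucvgX a; have [m bm] := ucvgX b.
    have lm : l = m.
      by apply: ucvg_mdist0 al bm _; apply: nearW => n; case: (abP n).
    have fa : f \o a @ uoo --> f l by apply: cf => // n; case: (abP n).
    have fb : f \o b @ uoo --> f m by apply: cf => // n; case: (abP n).
    have : eta <= d (f l) (f m).
      apply: ucvg_ge_cst (mdist_cvg fa fb) _; apply: nearW => n.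
      by case: (abP n) => _ _ _ /negP; rewrite -ltNge => /ltW.
    by rewrite lm mdistxx leNgt eta0.
  move=> A Afp Ac.
  have [|a b [Aa Da] Db ab|] := wD _ e0 _ Dy [set z | A (f z) /\ D z] => //.
  by split => //; apply: (Ac _ _ Aa _ (He _ _ Da Db ab)); exists b.
Qed.

End chains.

(** * Flows and phase functions *)

Section flow_basics.
Context {R : realType} {X : metricType R} {phi : R -> X -> X}.
Hypothesis phiF : is_flow phi.
Notation d := (@mdist R X).

Lemma flow0 x : phi 0 x = x. Proof. by case: phiF. Qed.

Lemma flowD s t x : phi s (phi t x) = phi (t + s) x.
Proof. by case: phiF => _ ->. Qed.

Lemma flowK t x : phi (- t) (phi t x) = x.
Proof. by rewrite flowD subrr flow0. Qed.

Lemma flowNK t x : phi t (phi (- t) x) = x.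
Proof. by rewrite flowD addNr flow0. Qed.

Lemma flow_cvg {T} {F : set_system T} {FF : Filter F} (t : T -> R) (x : T -> X) t0 x0 :
  t @ F --> t0 -> x @ F --> x0 -> (fun n => phi (t n) (x n)) @ F --> phi t0 x0.
Proof.
move=> tt xx; case: phiF => _ _ cphi.
by apply: (cvg_comp _ _ (cvg_pair tt xx) (cphi (t0, x0))).
Qed.

Hypothesis cX : compact [set: X].

Lemma flow_modulus T e : 0 < e -> exists2 delta : R, 0 < delta &
  forall s t x y, `|s| <= T -> `|t| <= T -> `|s - t| <= delta -> d x y <= delta ->
  d (phi s x) (phi t y) <= e.
Proof.
move=> e0; apply: ex_pos_harmonic => H.
have /choice[s /choice[t /choice[x /choice[y P]]]] : forall n : nat, exists s t x y,
   [/\ `|s| <= T, `|t| <= T, `|s - t| <= harmonic n, d x y <= harmonic n &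
     ~ d (phi s x) (phi t y) <= e].
  move=> n; have := H n => /existsNP[s] /existsNP[t] /existsNP[x] /existsNP[y].
  move=> /not_implyP[h1] /not_implyP[h2] /not_implyP[h3] /not_implyP[h4 h5].
  by exists s, t, x, y.
have [l xl] := ucvgX cX x; have [m ym] := ucvgX cX y.
have [s' _ ss] := ucvg_real (u := s) (M := T) ltac:(by move=> n; case: (P n)).
have [t' _ tt] := ucvg_real (u := t) (M := T) ltac:(by move=> n; case: (P n)).
have lm : l = m by apply: ucvg_mdist0 xl ym _; apply: nearW => n; case: (P n).
have st : s' = t'.
  apply/eqP; rewrite -subr_eq0; apply/eqP.
  have h0 : (fun n => s n - t n) @ uoo --> (0 : R).
    by apply: ucvg0; apply: nearW => n; case: (P n).
  by apply: (cvg_unique _ (cvgB ss tt) h0).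
have : e <= d (phi s' l) (phi t' m).
  apply: ucvg_ge_cst (mdist_cvg (flow_cvg ss xl) (flow_cvg tt ym)) _; apply: nearW => n.
  by case: (P n) => _ _ _ _ /negP; rewrite -ltNge => /ltW.
by rewrite lm st mdistxx leNgt e0.
Qed.

(** If [x n] is fixed at time [harmonic n] for every [n], it is fixed at all multiples of that time.
    These approximate any [t], so the limit of [x n] is a fixed point of the flow. *)
Lemma regular_no_period : regular_flow phi ->
  exists2 a : R, 0 < a & forall x, phi a x <> x.
Proof.
move=> reg; apply: ex_pos_harmonic => H.
have /choice[x xP] : forall n : nat, exists x, phi (harmonic n) x = x.
  by move=> n; have := H n => /existsNP[x /contrapT xx]; exists x.
have [l xl] := ucvgX cX x; apply: (reg l) => t.
have nat_per h z : phi h z = z -> forall m : nat, phi (h *+ m) z = z.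
  move=> hz; elim=> [|m IH]; first by rewrite mulr0n flow0.
  by rewrite mulrS -flowD hz.
have per h z : phi h z = z -> forall k : int, phi (h *~ k) z = z.
  move=> hz [m|m]; first by rewrite -pmulrn nat_per.
  by rewrite NegzE mulrNz -pmulrn -{1}(nat_per _ _ hz m.+1) flowK.
pose k n : int := Num.floor (t / harmonic n).
pose u n : R := harmonic n *~ k n.
have ut : u @ uoo --> t.
  rewrite -[t]addr0; apply: (@cvg_trans _ ((fun n => t + (u n - t)) @ uoo)).
    apply: near_eq_cvg; apply: nearW => n; lra.
  apply: cvgD; first exact: cvg_cst.
  apply: ucvg0; apply: nearW => n.
  have h0 := harmonic_gt0 n (R := R).
  have := floor_itv (t / harmonic n); rewrite -/(k n) => /andP[k1 k2].
  rewrite /u -mulrzr; move: k1 k2; rewrite intrD.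
  rewrite ler_pdivlMr// ltr_pdivrMr// => k1 k2.
  by rewrite ler_norml; apply/andP; split; lra.
have xl' : (fun n => phi (u n) (x n)) @ uoo --> phi t l by exact: flow_cvg.
have ux : (fun n => phi (u n) (x n)) = x by apply/funext => n; exact: per.
by rewrite ux in xl'; exact: (ucvg_unique xl' xl).
Qed.

(* The field [ph_incr] makes the zero set of [Gam x] near x a cross section
   of the flow through x, depending continuously on x. *)
Record phase_function (Gam : X -> X -> R) (c r tau : R) : Prop := PhaseFunction {
  ph_c0 : 0 < c;
  ph_r0 : 0 < r;
  ph_tau0 : 0 < tau;
  ph_tau1 : tau <= 1;
  ph_diag : forall x, Gam x x = 0;
  ph_cvg : forall T (F : set_system T) (x y : T -> X) (l m : X), Filter F ->
    x @ F --> l -> y @ F --> m -> (fun n => Gam (x n) (y n)) @ F --> Gam l m;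
  ph_incr : forall x y t, d x y <= r -> 0 <= t <= tau ->
    Gam x y + c * t <= Gam x (phi t y);
  ph_small : forall y t, `|t| <= tau -> d (phi t y) y <= r / 2
}.

(* With a such that phi a has no fixed point and c small, take
   u x y := sup_(0 <= s <= a) (c s - d (phi (- s) y) x); near x the supremum is
   attained at s away from a, hence grows at least at rate c along the flow. *)
Lemma phase_function_exists : regular_flow phi ->
  exists Gam c r tau, phase_function Gam c r tau.
Proof.
move=> /regular_no_period[a a0 aP].
have [c4 c40 c4P] : exists2 e : R, 0 < e & forall x, e <= d (phi (- a) x) x.
  apply: ex_pos_harmonic => H.
  have /choice[x xP] : forall n : nat, exists x, d (phi (- a) x) x <= harmonic n.
    move=> n; have := H n => /existsNP[x /negP]; rewrite -ltNge => /ltW.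
    by exists x.
  have [l xl] := ucvgX cX x.
  have : phi (- a) l = l.
    by apply: ucvg_mdist0 (flow_cvg (cvg_cst (- a)) xl) xl _; exact: nearW.
  by move=> h; apply: (aP l); rewrite -{2}(flowNK a l) h.
pose c' := c4 / 4; have c'0 : 0 < c' by rewrite divr_gt0.
pose c := c' / a; have c0 : 0 < c by rewrite divr_gt0.
have ca : c * a = c' by rewrite /c divfK// gt_eqF.
have [del del0 delP] := flow_modulus a (e := c' / 2) ltac:(by rewrite divr_gt0).
pose r := Num.min (c' / 2) del.
have r0 : 0 < r by rewrite /r lt_min del0 divr_gt0.
have rc : r <= c' / 2 by rewrite /r ge_min lexx.
have rdel : r <= del by rewrite /r ge_min lexx orbT.
have [tau1 tau10 tau1P] := flow_modulus a (e := r / 2) ltac:(by rewrite divr_gt0).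
pose tau := Num.min (Num.min tau1 del) (Num.min a 1).
have tau0 : 0 < tau by rewrite /tau !lt_min tau10 del0 a0 ltr01.
have [tt1 td ta tauL] : [/\ tau <= tau1, tau <= del, tau <= a & tau <= 1].
  by split; rewrite /tau !ge_min lexx ?orbT.
pose S x y := [set c * s - d (phi (- s) y) x | s in [set s : R | 0 <= s <= a]].
pose u x y := sup (S x y).
have Sub x y : has_ubound (S x y).
  exists (c * a) => _ [s /= /andP[s0 sa] <-].
  have := mdist_ge0 (phi (- s) y) x; have : c * s <= c * a by rewrite ler_wpM2l// ltW.
  lra.
have Sne x y : S x y !=set0.
  by exists (c * 0 - d (phi (- 0) y) x), 0 => //=; rewrite lexx ltW.
have u_ge x y s : 0 <= s <= a -> c * s - d (phi (- s) y) x <= u x y.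
  by move=> sa; apply: (ub_le_sup (Sub x y)); exists s.
have u_le x y M : (forall s, 0 <= s <= a -> c * s - d (phi (- s) y) x <= M) -> u x y <= M.
  by move=> h; apply: (ge_sup (Sne x y)) => _ [s /= sa <-]; exact: h.
have u_mod e : 0 < e -> exists2 delta : R, 0 < delta &
    forall x y x' y', d x x' <= delta -> d y y' <= delta -> u x y <= u x' y' + e.
  move=> e0; have e2 : 0 < e / 2 by rewrite divr_gt0.
  have [delta delta0 deltaP] := flow_modulus a e2.
  exists (Num.min delta (e / 2)); first by rewrite lt_min delta0.
  move=> x y x' y'; rewrite !le_min => /andP[xx1 xx2] /andP[yy1 yy2].
  apply: u_le => s sa; have := u_ge x' y' s sa.
  have : d (phi (- s) y) (phi (- s) y') <= e / 2.
    apply: deltaP => //; rewrite ?subrr ?normr0 ?(ltW delta0)// normrN ger0_norm//;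
      by case/andP: sa.
  have := metric_triangle (phi (- s) y') x' x.
  have := metric_triangle (phi (- s) y') (phi (- s) y) x'.
  have := metric_triangle (phi (- s) y') (phi (- s) y) x.
  have := metric_triangle (phi (- s) y') x x'.
  have := metric_triangle (phi (- s) y) (phi (- s) y') x'.
  have := metric_triangle (phi (- s) y) x x'.
  rewrite (metric_sym (phi (- s) y') (phi (- s) y)) (metric_sym x' x).
  lra.
have u_cvg T (F : set_system T) (x y : T -> X) (l m : X) : Filter F ->
    x @ F --> l -> y @ F --> m -> (fun n => u (x n) (y n)) @ F --> u l m.
  move=> FF xl ym; apply/cvgrPdist_le => e e0; have [del' del'0 P] := u_mod _ e0.
  near=> n.
  have h1 : d l (x n) <= del' by near: n; exact: metricType_numDomainType.cvgr_dist_le.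
  have h2 : d m (y n) <= del' by near: n; exact: metricType_numDomainType.cvgr_dist_le.
  have g1 := P _ _ _ _ h1 h2.
  have := P (x n) (y n) l m; rewrite !(metric_sym _ l) !(metric_sym _ m) => /(_ h1 h2) g2.
  by rewrite ler_norml; lra.
exists (fun x y => u x y - u x x), c, r, tau; split => //.
- by move=> x; rewrite subrr.
- by move=> T F x y l m FF xl ym; apply: cvgB; exact: u_cvg.
- move=> x y t xy /andP[t0 tt]; rewrite addrAC lerD2r -lerBrDr.
  apply: u_le => s /andP[s0 sa].
  (* An early time [s] is replaced by [s + t], which is still at most [a] and gains exactly
     [c * t]. *)
  have [sat|sat] := leP s (a - t).
    have := u_ge x (phi t y) (s + t); rewrite flowD opprD addrCA subrr addr0 => h.
    have : c * (s + t) - d (phi (- s) y) x <= u x (phi t y).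
      by apply: h; apply/andP; split; [exact: addr_ge0 | lra].
    lra.
  (* For [s] near [a], the point [phi (- s) y] is near [phi (- a) x], which is [4 * c'] away from
     [x]; the value at [s] is then so low that time [t], which leads back to [y], does better. *)
  have h1 : c * t - d (phi (- t) (phi t y)) x <= u x (phi t y).
    by apply: u_ge; apply/andP; split => //; lra.
  rewrite flowK metric_sym in h1.
  have h2 : d (phi (- a) x) (phi (- s) y) <= c' / 2.
    apply: delP.
    - by rewrite ler_norml; lra.
    - by rewrite ler_norml; lra.
    - by rewrite ler_norml; lra.
    - exact: le_trans rdel.
  have h3 := c4P x.
  have h4 := metric_triangle (phi (- a) x) (phi (- s) y) x.
  have h5 : c * s <= c * a by rewrite ler_wpM2l// ltW.
  have c44 : c4 = 4 * c' by rewrite /c' mulrC divfK.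
  lra.
- move=> y t tt; rewrite -[X in d _ X]flow0; apply: tau1P.
  + exact: le_trans ta.
  + by rewrite normr0 ltW.
  + by rewrite subr0; exact: le_trans tt1.
  + by rewrite mdistxx ltW.
Unshelve. all: by end_near. Qed.

End flow_basics.

Arguments phase_function {R X} phi Gam c r tau.

(** * Reparametrizations from offsets at integer times *)

Section interpolation.
Context {R : realType}.

(** The difference quotients of [t + k t] are at least 1/2, which gives monotonicity, surjectivity
    by the intermediate value theorem, and a 2-Lipschitz inverse. *)
Lemma lipschitz_Rep (k : R -> R) : k 0 = 0 ->
  (forall s t, `|k s - k t| <= `|s - t| / 2) -> Rep (fun t => t + k t).
Proof.
move=> k0 kL; pose h t : R := t + k t.
have hmono s t : s <= t -> (t - s) / 2 <= h t - h s.
  move=> st; have := kL t s; rewrite (ger0_norm (x := t - s)) ?subr_ge0//.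
  by rewrite ler_norml /h => /andP[? ?]; lra.
have hL s t : `|h s - h t| <= 2 * `|s - t|.
  have -> : h s - h t = (s - t) + (k s - k t) by rewrite /h; ring.
  by have := ler_normD (s - t) (k s - k t); have := kL s t; have := normr_ge0 (s - t); lra.
have lip_cont (f : R -> R) : (forall s t, `|f s - f t| <= 2 * `|s - t|) -> continuous f.
  move=> fL t; apply/cvgrPdist_lt => e e0; near=> s.
  apply: (le_lt_trans (fL t s)).
  rewrite -ltr_pdivlMl//; near: s; apply: cvgr_dist_lt => //.
  by rewrite mulr_gt0// invr_gt0.
have hc : continuous h by exact: lip_cont.
have h0 : h 0 = 0 by rewrite /h k0 addr0.
have surj v : exists t, h t = v.
  pose M : R := 2 * `|v| + 1.
  have M0 : 0 <= M by rewrite /M addr_ge0// mulr_ge0.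
  have hM : v <= h M.
    by have := hmono 0 M M0; have := ler_norm v; rewrite h0 /M; lra.
  have hNM : h (- M) <= v.
    have : h (- M) <= - (M / 2) by have := hmono (- M) 0; rewrite h0; lra.
    by have := ler_norm (- v); rewrite normrN /M; lra.
  have MM : - M <= M by lra.
  have [|t _ <-] := @IVT R h (- M) M v MM (continuous_subspaceT hc).
    by rewrite ge_min hNM le_max hM orbT.
  by exists t.
have hlt : {homo h : x y / x < y}.
  by move=> s t st; rewrite -subr_gt0; apply: lt_le_trans (hmono _ _ (ltW st)); lra.
have hinj : injective h.
  move=> s t hst; apply/eqP; rewrite eq_le; apply/andP; split; rewrite leNgt;
    apply/negP => /hlt; by rewrite hst ltxx.
have [g gP] := choice surj.
split => //; exists g; split => //.
- by move=> t; apply: hinj; rewrite gP.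
- apply: lip_cont => s t; rewrite -{2}(gP s) -{2}(gP t).
  have [st|ts] := leP (g s) (g t).
    rewrite distrC (distrC (h (g s))) (ger0_norm (x := g t - g s)) ?subr_ge0//.
    by have := hmono _ _ st; have := ler_norm (h (g t) - h (g s)); lra.
  rewrite (ger0_norm (x := g s - g t)) ?subr_ge0 ?(ltW ts)//.
  by have := hmono _ _ (ltW ts); have := ler_norm (h (g s) - h (g t)); lra.
Unshelve. all: by end_near. Qed.

Definition interpolate (a : int -> R) (t : R) : R :=
  a (Num.floor t) + (t - (Num.floor t)%:~R) * (a (Num.floor t + 1) - a (Num.floor t)).

(** The interval from [s] to [t] is cut at the first integer after [s] and the last one before [t];
    the middle part is a sum of whole increments. *)
Lemma interpolate_lipschitz (a : int -> R) (kap : R) :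
  (forall i, `|a (i + 1) - a i| <= kap) ->
  forall s t, `|interpolate a s - interpolate a t| <= kap * `|s - t|.
Proof.
move=> aL.
have kap0 : 0 <= kap by apply: le_trans (aL 0).
have aLn i (n : nat) : `|a (i + n%:Z) - a i| <= kap * n%:R.
  elim: n => [|n IH]; first by rewrite addr0 subrr normr0 mulr0.
  have -> : a (i + n.+1%:Z) - a i = (a (i + n%:Z + 1) - a (i + n%:Z)) + (a (i + n%:Z) - a i).
    by rewrite (_ : i + n.+1%:Z = i + n%:Z + 1); [ring | lia].
  apply: (le_trans (ler_normD _ _)); have := aL (i + n%:Z); rewrite -natr1; lra.
have main s t : s <= t -> `|interpolate a s - interpolate a t| <= kap * (t - s).
  move=> st; rewrite /interpolate; set i := Num.floor s; set j := Num.floor t.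
  have /andP[i1 i2] := floor_itv s; have /andP[j1 j2] := floor_itv t.
  rewrite -/i -/j in i1 i2 j1 j2; rewrite intrD in i2; rewrite intrD in j2.
  have ij : i <= j by exact: le_floor.
  have [e|ne] := eqVneq i j.
    rewrite -e; have -> : a i + (s - i%:~R) * (a (i + 1) - a i) -
      (a i + (t - i%:~R) * (a (i + 1) - a i)) = (s - t) * (a (i + 1) - a i) by ring.
    by rewrite normrM distrC (ger0_norm (x := t - s)) ?subr_ge0// mulrC ler_wpM2r ?subr_ge0.
  have ij1 : i + 1 <= j by rewrite lezD1 lt_neqAle ne.
  have [n jn] : exists n : nat, j = i + 1 + n%:Z.
    by exists (absz (j - (i + 1))%R); lia.
  have h1 := aLn (i + 1) n; rewrite -jn in h1.
  have jR : j%:~R = i%:~R + 1 + n%:R :> R by rewrite jn !intrD.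
  have h2 : `|(t - j%:~R) * (a (j + 1) - a j)| <= (t - j%:~R) * kap.
    by rewrite normrM ger0_norm ?ler_wpM2l// subr_ge0.
  have h3 : `|(i%:~R + 1 - s) * (a (i + 1) - a i)| <= (i%:~R + 1 - s) * kap.
    by rewrite normrM ger0_norm ?ler_wpM2l// subr_ge0 ltW.
  have -> : a i + (s - i%:~R) * (a (i + 1) - a i) - (a j + (t - j%:~R) * (a (j + 1) - a j))
     = - ((i%:~R + 1 - s) * (a (i + 1) - a i)) - (a j - a (i + 1)) -
       (t - j%:~R) * (a (j + 1) - a j) by ring.
  apply: (le_trans (ler_normB _ _)).
  have := ler_normB (- ((i%:~R + 1 - s) * (a (i + 1) - a i))) (a j - a (i + 1)).
  rewrite normrN => h4.
  have -> : kap * (t - s) = (i%:~R + 1 - s) * kap + kap * n%:R + (t - j%:~R) * kap.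
    by rewrite jR; ring.
  lra.
move=> s t; have [st|ts] := leP s t.
  by rewrite (distrC s) (ger0_norm (x := t - s)) ?subr_ge0// main.
by rewrite distrC (ger0_norm (x := s - t)) ?subr_ge0 ?(ltW ts)// main// ltW.
Qed.

Lemma interpolate_int (a : int -> R) i : interpolate a i%:~R = a i.
Proof. by rewrite /interpolate intrKfloor subrr mul0r addr0. Qed.

End interpolation.

(** * Covering dimension *)

Section sperner.
Implicit Types (k u v w z : option bool).

Definition bichromatic u v : bool :=
  if u is Some a then if v is Some b then a != b else false else false.

(** Around a square that misses a colour, the number of bichromatic edges is even: with only the two
    [Some] colours they are the colour changes along a cycle, and otherwise there are none. *)
Lemma square_parity k u v w z : u != k -> v != k -> w != k -> z != k ->
  bichromatic u v (+) bichromatic z w = bichromatic u z (+) bichromatic v w.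
Proof. by case: k u v w z => [[]|] [[]|] [[]|] [[]|] [[]|]. Qed.

(** If no cell had all three colours, the parity of bichromatic edges would be the same in every
    row, since the left and right sides contain none. But it is odd in the bottom row, which leads
    from [Some true] to [Some false], and the top row has no such edge. *)
Lemma sperner_grid (c : nat -> nat -> option bool) (n m : nat) :
  (forall j, c 0 j = Some true) -> (forall i, c i 0 <> None) ->
  (forall j, c n j <> Some true) -> (forall i, c i m <> Some false) ->
  exists i j, forall k, exists di dj : bool, c (i + di)%N (j + dj)%N = k.
Proof.
move=> left bottom right top; apply: contrapT => H.
have sq i j : bichromatic (c i j) (c i.+1 j) (+) bichromatic (c i j.+1) (c i.+1 j.+1)
   = bichromatic (c i j) (c i j.+1) (+) bichromatic (c i.+1 j) (c i.+1 j.+1).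
  have [k kP] : exists k, forall di dj : bool, c (i + di)%N (j + dj)%N != k.
    apply: contrapT => H'; apply: H; exists i, j => k; apply: contrapT => H''.
    by apply: H'; exists k => di dj; apply/eqP => e; apply: H''; exists di, dj.
  apply: (@square_parity k).
  - by have := kP false false; rewrite !addn0.
  - by have := kP true false; rewrite addn1 addn0.
  - by have := kP true true; rewrite !addn1.
  - by have := kP false true; rewrite addn1 addn0.
pose h l j := \big[addb/false]_(i < l) bichromatic (c i j) (c i.+1 j).
have hS l j : h l.+1 j = h l j (+) bichromatic (c l j) (c l.+1 j).
  by rewrite /h big_ord_recr.
have strip l j : h l j (+) h l j.+1 = bichromatic (c l j) (c l j.+1).
  elim: l => [|l IH]; first by rewrite /h !big_ord0 !left.
  by rewrite !hS addbACA IH sq addbA addbb.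
have hn j : h n j = h n 0%N.
  elim: j => [//|j <-]; have := strip n j.
  move: (right j) (right j.+1).
  by case: (c n j) (c n j.+1) => [[]|] [[]|] //=; case: (h n j) (h n j.+1) => [] [].
have hm l : h l m = false.
  elim: l => [|l IH]; first by rewrite /h big_ord0.
  by rewrite hS IH; move: (top l) (top l.+1); case: (c l m) (c l.+1 m) => [[]|] [[]|].
have h0 l : h l 0%N = (c l 0%N != Some true).
  elim: l => [|l IH]; first by rewrite /h big_ord0 left.
  by rewrite hS IH; move: (bottom l) (bottom l.+1); case: (c l 0%N) (c l.+1 0%N) => [[]|] [[]|].
have := hn m; rewrite hm h0 => /esym/negbFE/eqP; exact: right.
Qed.

End sperner.

(** * Nets, Lebesgue numbers and explicit chains *)

Section metric_covers.
Context {R : realType} {X : metricType R}.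
Notation d := (@mdist R X).

Lemma open_ball_mdist (A : set X) z : open A -> A z ->
  exists2 e : R, 0 < e & forall w, d z w < e -> A w.
Proof.
move=> oA Az; have : nbhs z A by exact: open_nbhs_nbhs.
by move=> /nbhs_ballP[e /= e0]; rewrite ballEmdist => H; exists e.
Qed.

Lemma open_mdist_ball (z : X) (e : R) : open [set w | d z w < e].
Proof.
rewrite openE => w /= zw; apply/nbhs_ballP; exists (e - d z w); first by rewrite /= subr_gt0.
by rewrite ballEmdist => v /= wv; have := metric_triangle z w v; lra.
Qed.

Lemma compact_net (A : set X) (e : R) : compact A -> 0 < e ->
  exists (k : nat) (s : 'I_k -> X), (forall i, A (s i)) /\
    forall z, A z -> exists i, d (s i) z < e.
Proof.
move=> cA e0; apply: contrapT => H.
have far (s : seq X) : (forall w, w \in s -> A w) ->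
    exists2 z, A z & forall w, w \in s -> e <= d w z.
  move=> sA; apply: contrapT => H'; apply: H.
  exists (size s), (fun i => tnth (in_tuple s) i); split.
    by move=> i; apply: sA; rewrite mem_tnth.
  move=> z Az; apply: contrapT => H''; apply: H'; exists z => // w ws.
  have /tnthP[i wi] : w \in in_tuple s by [].
  by rewrite leNgt; apply/negP => h; apply: H''; exists i; rewrite -wi.
have /choice[f fP] : forall s : seq X, exists z, (forall w, w \in s -> A w) ->
    A z /\ forall w, w \in s -> e <= d w z.
  move=> s; case: (pselect (forall w, w \in s -> A w)) => [/far[z Az zP]|].
    by exists z.
  by case: s => [|w s] nA; [case: nA | exists w].
(* [L n] lists the first [n] points chosen greedily, each at distance at least [e] from the previous
   ones; such a sequence has no ultralimit. *)
pose L := fix L (n : nat) : seq X := if n is m.+1 then f (L m) :: L m else [::].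
have LA n : forall w, w \in L n -> A w.
  elim: n => [//|n IH] w; rewrite inE => /orP[/eqP->|]; last exact: IH.
  exact: (fP _ IH).1.
have L_in i n : (i < n)%N -> f (L i) \in L n.
  elim: n => [//|n IH]; rewrite ltnS leq_eqVlt inE => /orP[/eqP->|/IH ->].
    by rewrite eqxx.
  by rewrite orbT.
have sep i n : (i < n)%N -> e <= d (f (L i)) (f (L n)).
  by move=> /L_in; exact: (fP _ (LA n)).2.
have [l _ fl] := ucvg_compact cA (x := f \o L) (fun n => (fP _ (LA n)).1).
have e2 : 0 < e / 2 by rewrite divr_gt0.
have near_l := ucvg_dist_lt fl e2.
have [i li] := filter_ex near_l.
have [n [ln /= ni]] := filter_ex (filterI near_l (uoo_ge i.+1)).
have := sep _ _ ni; have := metric_triangle (f (L i)) l (f (L n)).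
by rewrite (metric_sym (f (L i)) l); move: li ln => /=; lra.
Qed.

Lemma lebesgue_number (A : set X) (m : nat) (V : 'I_m -> set X) : compact A ->
  (forall j, open (V j)) -> A `<=` \bigcup_j V j ->
  exists2 lam : R, 0 < lam & forall z, A z -> exists j, forall w, d z w < lam -> V j w.
Proof.
move=> cA oV AV; apply: ex_pos_harmonic => H.
have /choice[z zP] : forall n : nat, exists z, A z /\
    ~ exists j, forall w, d z w < harmonic n -> V j w.
  by move=> n; have := H n => /existsNP[z] /not_implyP[Az hz]; exists z.
have [l Al zl] := ucvg_compact cA (x := z) (fun n => proj1 (zP n)).
have [j _ Vl] := AV _ Al; have [e e0 eP] := open_ball_mdist (oV j) Vl.
have e2 : 0 < e / 2 by rewrite divr_gt0.
have [n [h1 h2]] := filter_ex (filterI (uoo_harmonic_lt e2)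
  (ucvg_dist_lt zl e2)).
have [_] := zP n; apply; exists j => w zw; apply: eP.
by have := metric_triangle l (z n) w; lra.
Qed.

(** The chain is an eventually constant sequence on all of [nat], so that no index bounds are needed
    when a grid is built on it. *)
Lemma chained_path (D : set X) (eta : R) x y : D x -> 0 <= eta -> chained D eta x y ->
  exists (n : nat) (z : nat -> X), [/\ z 0%N = x, z n = y, forall i, D (z i) &
     forall i, d (z i) (z i.+1) <= eta].
Proof.
move=> Dx eta0 xy.
pose A y := exists (n : nat) (z : nat -> X), [/\ z 0%N = x, forall i, (n <= i)%N -> z i = y,
  forall i, D (z i) & forall i, d (z i) (z i.+1) <= eta].
have [|a b [n [z [z0 zn zD zd]]] Db ab|n [z [z0 zn zD zd]]] := xy A.
- by exists 0%N, (fun=> x); split => // i; rewrite mdistxx.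
- exists n.+1, (fun i => if (i <= n)%N then z i else b); split => //.
  + by move=> i; case: leqP.
  + by move=> i; case: leqP.
  + move=> i; case: (leqP i n) => ni; last by rewrite leqNgt ltnW//= mdistxx.
    by case: (leqP i.+1 n) => // nni; rewrite zn//.
- by exists n, z; split => //; rewrite zn.
Qed.

End metric_covers.

(** * Strips and Lebesgue's covering theorem *)

Section transverse.
Context {R : realType} {X : metricType R} {phi : R -> X -> X}.
Hypothesis phiF : is_flow phi.
Hypothesis cX : compact [set: X].
Notation d := (@mdist R X).

(* A strip D x [0,a] inside a set of dimension at most 1 would contradict
   Lebesgue's covering theorem, applied to fine chains in D joining the
   points x and y. *)
Lemma cover_dim1_strip (K D : set X) (a : R) x y : compact K -> cover_dim_le K 1 ->
  0 < a -> well_chained x D -> D y ->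
  (forall z t, D z -> 0 <= t <= a -> K (phi t z)) ->
  (forall s t, 0 <= s <= a -> 0 <= t <= a -> phi s x <> phi t y) ->
  (forall z w, D z -> D w -> z <> phi a w) -> False.
Proof.
move=> cK dimK a0 [cD Dx xD] Dy DK side1 side2.
have [e1 e10 e1P] : exists2 e : R, 0 < e & forall s t, 0 <= s <= a -> 0 <= t <= a ->
    e <= d (phi s x) (phi t y).
  apply: ex_pos_harmonic => H.
  have /choice[s /choice[t P]] : forall n : nat, exists s t : R,
      [/\ 0 <= s <= a, 0 <= t <= a & d (phi s x) (phi t y) <= harmonic n].
    move=> n; have := H n => /existsNP[s] /existsNP[t] /not_implyP[h1] /not_implyP[h2].
    by move=> /negP; rewrite -ltNge => /ltW h3; exists s, t.
  have bnd (u : nat -> R) : (forall n, 0 <= u n <= a) -> exists2 l, 0 <= l <= a & u @ uoo --> l.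
    move=> ua; have [l _ ul] := ucvg_real (u := u) (M := a)
      ltac:(by move=> n; have /andP[h1 h2] := ua n; rewrite ger0_norm).
    exists l => //; apply/andP; split.
      by apply: ucvg_ge_cst ul _; apply: nearW => n; case/andP: (ua n).
    by apply: ucvg_le_cst ul _; apply: nearW => n; case/andP: (ua n).
  have [s' s'a ss] := bnd s ltac:(by move=> n; case: (P n)).
  have [t' t'a tt] := bnd t ltac:(by move=> n; case: (P n)).
  apply: (side1 _ _ s'a t'a).
  apply: ucvg_mdist0 (flow_cvg phiF ss (cvg_cst x)) (flow_cvg phiF tt (cvg_cst y)) _.
  by apply: nearW => n; case: (P n).
have [e2 e20 e2P] : exists2 e : R, 0 < e & forall z w, D z -> D w -> e <= d z (phi a w).
  apply: ex_pos_harmonic => H.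
  have /choice[z /choice[w P]] : forall n : nat, exists z w,
      [/\ D z, D w & d z (phi a w) <= harmonic n].
    move=> n; have := H n => /existsNP[z] /existsNP[w] /not_implyP[h1] /not_implyP[h2].
    by move=> /negP; rewrite -ltNge => /ltW h3; exists z, w.
  have [z' zz] := ucvgX cX z; have [w' ww] := ucvgX cX w.
  apply: (side2 z' w').
  - by apply: closed_ucvg cD _ zz; apply: nearW => n; case: (P n).
  - by apply: closed_ucvg cD _ ww; apply: nearW => n; case: (P n).
  - apply: ucvg_mdist0 zz (flow_cvg phiF (cvg_cst a) ww) _.
    by apply: nearW => n; case: (P n).
(* [e1] separates the left side from the right one and [e2] the bottom from the top, so a cover set
   of diameter below [eta] cannot meet two opposite sides. *)
pose eta := Num.min e1 e2; have eta0 : 0 < eta by rewrite lt_min e10.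
have [ee1 ee2] : eta <= e1 /\ eta <= e2 by split; rewrite /eta ge_min lexx ?orbT.
have eta2 : 0 < eta / 2 by rewrite divr_gt0.
have [k [s [sK sP]]] := compact_net cK eta2.
have [||M [V [oV KV VU Vord]]] := dimK k (fun i => [set w | d (s i) w < eta / 2]).
- by move=> i; exact: open_mdist_ball.
- by move=> z /sP[i iz]; exists i.
have Vsmall j u v : V j u -> V j v -> d u v < eta.
  have [i ij] := VU j; move=> /ij /= h1 /ij /= h2.
  by have := metric_triangle u (s i) v; rewrite (metric_sym u (s i)); lra.
have [lam lam0 lamP] := lebesgue_number cK oV KV.
have lam2 : 0 < lam / 2 by rewrite divr_gt0.
have [del del0 delP] := flow_modulus phiF cX a lam2.
have [n [z [z0 zn zD zd]]] := chained_path Dx (ltW del0) (xD _ del0 _ Dy).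
pose m := (Num.bound (a / del)).+1.
have m0 : 0 < m%:R :> R by rewrite ltr0n.
have am : a / m%:R <= del.
  rewrite ler_pdivrMr// mulrC -ler_pdivrMr//.
  apply: (le_trans (ltW (archi_boundP (divr_ge0 (ltW a0) (ltW del0))))).
  by rewrite ler_nat.
pose t j : R := a * ((minn j m)%:R / m%:R).
have t_itv j : 0 <= t j <= a.
  apply/andP; split; first by rewrite /t mulr_ge0 ?divr_ge0 ?ler0n// ltW.
  rewrite /t ger_pMr// ler_pdivrMr// mul1r ler_nat; exact: geq_minr.
have tS j : `|t j.+1 - t j| <= del.
  have -> : t j.+1 - t j = (a / m%:R) * ((minn j.+1 m)%:R - (minn j m)%:R).
    by rewrite /t; field; rewrite gt_eqF.
  rewrite normrM ger0_norm ?divr_ge0 ?ler0n ?(ltW a0)//.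
  apply: le_trans am; rewrite ger_pMr ?divr_gt0//.
  have [jm|jm] := leqP m j.
    by rewrite (minn_idPr (leqW jm)) subrr normr0 ler01.
  by rewrite (minn_idPl jm) -natrB// subSnn normr1.
have t0 : t 0%N = 0 by rewrite /t min0n mul0r mulr0.
have tm : t m = a by rewrite /t minnn divff ?mulr1// gt_eqF.
pose v i j := phi (t j) (z i).
have vK i j : K (v i j) by exact: DK.
have /choice[lab0 labP0] : forall ij : nat * nat, exists l, forall w,
    d (v ij.1 ij.2) w < lam -> V l w.
  by move=> [i j]; exact: lamP.
pose lab i j := lab0 (i, j).
have labP i j w : d (v i j) w < lam -> V (lab i j) w by exact: (labP0 (i, j)).
have Vv i j : V (lab i j) (v i j) by apply: labP; rewrite mdistxx.
(* The colour of a vertex is read off the cover set that labels it; the left side takes precedence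
   over the bottom. *)
pose touches_left l := `[< exists2 s, 0 <= s <= a & V l (phi s x) >].
pose touches_bottom l := `[< exists2 w, D w & V l w >].
pose col l : option bool :=
  if touches_left l then Some true else if touches_bottom l then Some false else None.
have [||||i [j ijP]] := @sperner_grid (fun i j => col (lab i j)) n m.
- move=> j; rewrite /col /touches_left asboolT//.
  by exists (t j) => //; rewrite -z0; exact: Vv.
- move=> i; rewrite /col; case: ifP => // _; rewrite /touches_bottom asboolT//.
  by exists (z i) => //; have := Vv i 0%N; rewrite /v t0 flow0.
- move=> j; rewrite /col; case: ifP => [/asboolP[s' s'a Vs] _|_]; last by case: ifP.
  have := Vsmall _ _ _ Vs (Vv n j); rewrite /v zn.
  by have := e1P _ _ s'a (t_itv j); lra.
- move=> i; rewrite /col; case: ifP => // _; case: ifP => // /asboolP[w Dw Vw] _.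
  have := Vsmall _ _ _ Vw (Vv i m); rewrite /v tm.
  by have := e2P _ _ Dw (zD i); lra.
(* Cells are so small that the cover set labelling any corner contains [v i j]; three colours thus
   give three distinct cover sets at one point. *)
have Vij (di dj : bool) : V (lab (i + di)%N (j + dj)%N) (v i j).
  apply: labP; apply: (@le_lt_trans _ _ (lam / 2)); last by lra.
  have norm_t l : `|t l| <= a by have /andP[h1 h2] := t_itv l; rewrite ger0_norm.
  apply: delP => //.
    by case: dj; rewrite ?addn1 ?addn0 ?subrr ?normr0 ?(ltW del0).
  by case: di; rewrite ?addn1 ?addn0 ?mdistxx ?(ltW del0)// metric_sym.
have [di1 [dj1 c1]] := ijP (Some true).
have [di2 [dj2 c2]] := ijP (Some false).
have [di3 [dj3 c3]] := ijP None.
have := Vord _ (vK i j); rewrite leqNgt => /negP; apply.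
set l1 := lab _ _ in c1; set l2 := lab _ _ in c2; set l3 := lab _ _ in c3.
have l12 : l1 != l2 by apply: contraPneq c1 => ->; rewrite c2.
have l13 : l1 != l3 by apply: contraPneq c1 => ->; rewrite c3.
have l23 : l2 != l3 by apply: contraPneq c2 => ->; rewrite c3.
have : #|[set l1; l2; l3]%SET| = 3%N.
  by rewrite -finset.setUA !cardsU1 cards1 !inE negb_or l12 l13 l23.
move=> <-; apply: subset_leq_card; apply/fintype.subsetP => l; rewrite !inE.
by move=> /orP[/orP[]|] /eqP->; apply/asboolP; exact: Vij.
Qed.

End transverse.

Lemma int_between (f l : int) : f < l + 1 -> l < f + 1 + 1 -> l = f \/ l = f + 1.
Proof. by lia. Qed.

(** * Covering dimension of finite closed unions *)

Section covering_dimension.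
Context {R : realType} {X : metricType R}.
Implicit Types (A B : set X) (n k : nat).

Definition cover_order_le A n (T : finType) (V : T -> set X) :=
  forall x, A x -> (#|[set j : T | `[< V j x >]]| <= n.+1)%N.

(** Members of a refinement assigned to the same [U i] are merged; this does not raise the order, as
    the members at a point map onto the merged ones. *)
Lemma cover_dim_le_indexed A n k (U : 'I_k -> set X) : cover_dim_le A n ->
  (forall i, open (U i)) -> A `<=` \bigcup_i U i ->
  exists W : 'I_k -> set X, [/\ forall i, open (W i), A `<=` \bigcup_i W i,
     forall i, W i `<=` U i & cover_order_le A n W].
Proof.
move=> dA oU AU; have [m [V [oV AV /choice[f fP] Vord]]] := dA k U oU AU.
exists (fun i => \bigcup_(j in [set j | f j = i]) V j); split.
- by move=> i; apply: bigcup_open.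
- by move=> x /AV[j _ Vj]; exists (f j) => //; exists j.
- by move=> i x [j /= <-]; exact: fP.
- move=> x Ax; apply: leq_trans (Vord x Ax).
  apply: leq_trans (leq_imset_card f _); apply: subset_leq_card.
  apply/fintype.subsetP => i; rewrite inE => /asboolP[j /= fj Vj].
  by apply/imsetP; exists j => //; rewrite inE; apply/asboolP.
Qed.

Lemma cover_dim_le_finType A n :
  (forall k (U : 'I_k -> set X), (forall i, open (U i)) -> A `<=` \bigcup_i U i ->
    exists (T : finType) (V : T -> set X), [/\ forall j, open (V j), A `<=` \bigcup_j V j,
      forall j, exists i, V j `<=` U i & cover_order_le A n V]) ->
  cover_dim_le A n.
Proof.
move=> H k U oU AU; have [T [V [oV AV VU Vord]]] := H k U oU AU.
exists #|T|, (V \o enum_val); split.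
- by move=> j; exact: oV.
- by move=> x /AV[j _ Vj]; exists (enum_rank j) => //=; rewrite enum_rankK.
- by move=> j; exact: VU.
- move=> x Ax; apply: leq_trans (Vord x Ax).
  rewrite -(card_imset _ (@enum_val_inj _ T)); apply: subset_leq_card.
  by apply/fintype.subsetP => j /imsetP[i + ->]; rewrite !inE.
Qed.

Lemma cover_dim_le_set0 n : cover_dim_le (@set0 X) n.
Proof. by move=> k U _ _; exists 0%N, (fun=> set0); split => // -[]. Qed.

(* Refine the cover on A, restore the sets off A, then do the same with B: the
   second refinement cannot increase the order on A since it is indexed by the
   same sets. *)
Lemma cover_dim_le_setU A B n : closed A -> closed B ->
  cover_dim_le A n -> cover_dim_le B n -> cover_dim_le (A `|` B) n.
Proof.
move=> cA cB dA dB; apply: cover_dim_le_finType => k U oU ABU.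
have [|W [oW AW WU Word]] := cover_dim_le_indexed dA oU.
  by move=> x Ax; apply: ABU; left.
pose W' i := W i `|` (U i `&` ~` A).
have oW' i : open (W' i) by apply: openU => //; apply: openI => //; exact: closed_openC.
have BW' : B `<=` \bigcup_i W' i.
  move=> x Bx; case: (pselect (A x)) => [/AW[i _ Wi]|nAx]; first by exists i => //; left.
  by have [|i _ Ui] := ABU x; [right | exists i => //; right].
have [W2 [oW2 BW2 W2W' W2ord]] := cover_dim_le_indexed dB oW' BW'.
exists 'I_k, (fun i => W2 i `|` (W' i `&` ~` B)).
have sub i : W2 i `|` (W' i `&` ~` B) `<=` W' i by move=> x [/W2W'|[]].
split.
- by move=> i; apply: openU => //; apply: openI => //; exact: closed_openC.
- move=> x ABx; case: (pselect (B x)) => [/BW2[i _ Wi]|nBx]; first by exists i => //; left.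
  by case: ABx => // /AW[i _ Wi]; exists i => //; right; split => //; left.
- by move=> i; exists i => x /sub[/WU//|[]].
- move=> x [Ax|Bx].
    apply: leq_trans (Word x Ax); apply: subset_leq_card; apply/fintype.subsetP => i.
    by rewrite !inE => /asboolP/sub[Wi|[]//]; apply/asboolP.
  apply: leq_trans (W2ord x Bx); apply: subset_leq_card; apply/fintype.subsetP => i.
  by rewrite !inE => /asboolP[Wi|[]//]; apply/asboolP.
Qed.

Lemma cover_dim_le_bigsetU k (A : nat -> set X) n : (forall i, closed (A i)) ->
  (forall i, cover_dim_le (A i) n) -> cover_dim_le (\big[setU/set0]_(i < k) A i) n.
Proof.
move=> cA dA; elim: k => [|k IH]; first by rewrite big_ord0; exact: cover_dim_le_set0.
rewrite big_ord_recr /=; apply: cover_dim_le_setU => //.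
by apply: closed_bigsetU.
Qed.

End covering_dimension.

(** * Minimal subsets *)

Section minimal.
Context {R : realType} {X : metricType R} {phi : R -> X -> X}.
Hypothesis phiF : is_flow phi.
Hypothesis cX : compact [set: X].

Lemma flow_invariantP (K : set X) :
  (forall t z, K z -> K (phi t z)) -> flow_invariant phi K.
Proof.
move=> inv t; apply/seteqP; split => [_ [z Kz <-]|z Kz]; first exact: inv.
by exists (phi (- t) z); [exact: inv | exact: flowNK].
Qed.

Lemma flow_invariant_in (K : set X) t z : flow_invariant phi K -> K z -> K (phi t z).
Proof. by move=> invK Kz; rewrite -(invK t); exists z. Qed.

(** Zorn's lemma for unions is applied to the sets [A] removed from [M0]; a maximal [A] leaves a
    minimal remainder [N A]. *)
Lemma minimal_subset_exists (M0 : set X) : M0 !=set0 -> closed M0 ->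
  flow_invariant phi M0 -> exists2 M, minimal_subset phi M & M `<=` M0.
Proof.
move=> M0ne cM0 invM0; pose N A := M0 `&` ~` A.
pose P A := [/\ N A !=set0, closed (N A) & flow_invariant phi (N A)].
have [F FP Fchain|A [[NA0 cNA invNA] Amax]] := @Zorn_bigcup X P.
  have inN z : M0 z -> (forall A, F A -> N A z) -> N (\bigcup_(A in F) A) z.
    by move=> M0z NAz; split => // -[A FA]; case: (NAz _ FA).
  have ofN z A : F A -> N (\bigcup_(A in F) A) z -> N A z.
    by move=> FA [M0z nA]; split => // Az; apply: nA; exists A.
  split.
  (* The empty chain leaves [M0] itself. Otherwise the remainders form a filter base of closed sets,
     and a cluster point lies in all of them. *)
  - case: (pselect (exists A, F A)) => [[A0 FA0]|nF]; last first.
      by have [z M0z] := M0ne; exists z; apply: inN => // A FA; case: nF; exists A.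
    have proper : ProperFilter (filter_from F N).
      apply: filter_from_proper; last by move=> A /FP[].
      apply: filter_from_filter; first by exists A0.
      move=> A B FA FB; case: (Fchain A B FA FB) => AB.
        by exists B => // z [M0z nB]; do !split => //; move=> /AB.
      by exists A => // z [M0z nA]; do !split => //; move=> /AB.
    have [z [_ zP]] := cX proper filterT.
    have zN A : F A -> N A z.
      move=> FA; have [_ cA _] := FP _ FA; apply: cA => B zB.
      have : filter_from F N (N A) by exists A.
      by move=> /zP /(_ zB).
    by exists z; apply: inN => //; case: (zN _ FA0).
  - apply: ucvg_closed => x l Nx xl; apply: inN.
      by apply: closed_ucvg cM0 _ xl; apply: nearW => n; case: (Nx n).
    move=> A FA; have [_ cA _] := FP _ FA; apply: closed_ucvg cA _ xl.
    by apply: nearW => n; exact: ofN (Nx n).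
  - apply: flow_invariantP => t z Nz; apply: inN.
      by apply: flow_invariant_in => //; case: Nz.
    move=> A FA; have [_ _ iA] := FP _ FA; apply: flow_invariant_in => //.
    exact: ofN Nz.
exists (N A); last by move=> z [].
split => //; first by exact: subclosed_compact cNA cX _.
move=> N' N'N N'0 cN' invN'; apply/seteqP; split => // z Nz; apply: contrapT => nN'z.
have N'E : N (~` N') = N'.
  by apply/seteqP; split => [y []|y N'y]; rewrite ?setCK//; split; [case: (N'N _ N'y) | rewrite setCK].
apply: (Amax (~` N')); last first.
  by rewrite /P N'E; split => //; apply: compact_closed => //; exact: metric_hausdorff.
split; first by move=> y Ay /N'N[].
by move=> /(_ z nN'z); case: Nz.
Qed.

(** The points whose orbits visit [F] with gaps bounded by [L] form a closed invariant set; it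
    misses [K], since the orbit of a point of [K] never meets [F]. *)
Lemma minimal_subset_avoiding (K F : set X) (L : R) (y : X) : flow_invariant phi K ->
  closed F -> F `&` K = set0 ->
  (forall t, exists2 u, `|u - t| <= L & F (phi u y)) ->
  exists M, minimal_subset phi M /\ M `&` K = set0.
Proof.
move=> invK cF FK yP.
pose M0 := [set z | forall t, exists2 u, `|u - t| <= L & F (phi u z)].
have [|||M Mmin MM0] := @minimal_subset_exists M0.
- by exists y.
- apply: ucvg_closed => z l Mz zl t.
  have /choice[u uP] : forall n, exists u, `|u - t| <= L /\ F (phi u (z n)).
    by move=> n; have [u] := Mz n t; exists u.
  have [v vL uv] := ucvg_real (u := fun n => u n - t) (fun n => proj1 (uP n)).
  exists (v + t); first by rewrite addrK.
  have uv' : u @ uoo --> v + t.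
    rewrite (_ : u = fun n => (u n - t) + t); last by apply/funext => n; rewrite subrK.
    by apply: cvgD => //; exact: cvg_cst.
  apply: closed_ucvg cF _ (flow_cvg phiF uv' zl).
  by apply: nearW => n; case: (uP n).
- apply: flow_invariantP => s z Mz t; have [u us Fu] := Mz (s + t).
  exists (u - s); first by rewrite -addrA -opprD.
  by rewrite flowD// addrC subrK.
exists M; split => //; apply/seteqP; split => // z [/MM0 Mz Kz].
have [u _ Fu] := Mz 0.
have : (F `&` K) (phi u z) by split => //; exact: flow_invariant_in.
by rewrite FK.
Qed.

End minimal.

(** * Cross sections and unstable continua *)

Section cross_sections.
Context {R : realType} {X : metricType R} {phi : R -> X -> X}.
Hypothesis phiF : is_flow phi.
Hypothesis cX : compact [set: X].
Context {Gam : X -> X -> R} {c r tau : R}.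
Hypothesis phG : phase_function phi Gam c r tau.
Notation d := (@mdist R X).
Implicit Types (x y z : X) (s t e : R) (D : set X).

Let r0 : 0 < r. Proof. by case: phG. Qed.
Let c0 : 0 < c. Proof. by case: phG. Qed.
Let tau0 : 0 < tau. Proof. by case: phG. Qed.

Local Ltac plra := move: (r0) (c0) (tau0) => ? ? ?; lra.

Lemma phase_near x y t : d x y <= r / 2 -> `|t| <= tau -> d x (phi t y) <= r.
Proof.
move=> xy tt; have := ph_small phG y tt; have := metric_triangle x y (phi t y).
by rewrite (metric_sym y); plra.
Qed.

(** This is [ph_incr] at the earlier of the two times; it makes a short orbit piece near [x] cross
    the section at most once. *)
Lemma phase_sep x y s t : d x (phi s y) <= r -> d x (phi t y) <= r ->
  `|s - t| <= tau -> c * `|s - t| <= `|Gam x (phi s y) - Gam x (phi t y)|.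
Proof.
have main u v : u <= v -> d x (phi u y) <= r -> `|u - v| <= tau ->
    c * `|u - v| <= `|Gam x (phi u y) - Gam x (phi v y)|.
  move=> uv du; rewrite distrC (ger0_norm (x := v - u)) ?subr_ge0// => uvt.
  have := ph_incr phG (x := x) (y := phi u y) (t := v - u) du.
  rewrite flowD// (_ : u + (v - u) = v) ?subr_ge0 ?uv ?uvt => [/(_ isT) h|]; last ring.
  by rewrite distrC; have := ler_norm (Gam x (phi v y) - Gam x (phi u y)); plra.
move=> ds dt st; have [h|h] := leP s t; first exact: main.
by rewrite distrC (distrC (Gam _ _)); apply: main; [exact: ltW | | rewrite distrC].
Qed.

Lemma phase_inj x y s t : d x y <= r / 2 -> `|s| <= tau / 2 -> `|t| <= tau / 2 ->
  Gam x (phi s y) = Gam x (phi t y) -> s = t.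
Proof.
move=> xy s2 t2 e.
have st : `|s - t| <= tau by have := ler_normB s t; plra.
have ds : d x (phi s y) <= r by apply: phase_near => //; plra.
have dt : d x (phi t y) <= r by apply: phase_near => //; plra.
have := phase_sep ds dt st; rewrite e subrr normr0 pmulr_rle0//.
by rewrite normr_le0 subr_eq0 => /eqP.
Qed.

(** The time that brings [y] onto the section at [x]. The default 0 keeps [theta_le] unconditional,
    and [tau / 8] is below the uniqueness range [tau / 2] of [phase_inj]. *)
Definition theta x y : R := xget 0 [set t | `|t| <= tau / 8 /\ Gam x (phi t y) = 0].
Definition proj x y := phi (theta x y) y.
Definition step s (p : X * X) := (phi s p.1, proj (phi s p.1) (phi s p.2)).
Definition inphase e (p : X * X) := Gam p.1 p.2 = 0 /\ d p.1 p.2 <= e.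

Lemma theta_le x y : `|theta x y| <= tau / 8.
Proof.
rewrite /theta; case: xgetP => [t _ []//|_].
by rewrite normr0 divr_ge0// ltW.
Qed.

Lemma theta_eq x y t : d x y <= r / 2 -> `|t| <= tau / 8 -> Gam x (phi t y) = 0 ->
  theta x y = t.
Proof.
move=> xy t8 Gt; rewrite /theta; case: xgetP => [s _ [s8 Gs]|].
  by apply: (phase_inj xy); rewrite ?Gt ?Gs//; plra.
by move=> /(_ t)[].
Qed.

Lemma inphase_theta x y : d x y <= r / 2 -> Gam x y = 0 -> theta x y = 0.
Proof.
by move=> xy G0; apply: theta_eq; rewrite ?flow0// normr0 divr_ge0// ltW.
Qed.

Lemma inphase_proj x y : d x y <= r / 2 -> Gam x y = 0 -> proj x y = y.
Proof. by move=> xy G0; rewrite /proj inphase_theta// flow0. Qed.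

Lemma proj_diag x : proj x x = x.
Proof. by apply: inphase_proj; rewrite ?(ph_diag phG)// mdistxx divr_ge0// ltW. Qed.

Lemma phase_modulus e : 0 < e -> exists2 delta : R, 0 < delta &
  forall x y, d x y <= delta -> `|Gam x y| <= e.
Proof.
move=> e0; apply: ex_pos_harmonic => H.
have /choice[x /choice[y P]] : forall n : nat, exists x y,
    d x y <= harmonic n /\ ~ `|Gam x y| <= e.
  move=> n; have := H n => /existsNP[x] /existsNP[y] /not_implyP[h1 h2].
  by exists x, y.
have [l xl] := ucvgX cX x; have [m ym] := ucvgX cX y.
have lm : l = m by apply: ucvg_mdist0 xl ym _; apply: nearW => n; case: (P n).
have G0 : (fun n => Gam (x n) (y n)) @ uoo --> Gam l m by exact: (ph_cvg phG).
have : e <= `|Gam l m|.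
  apply: ucvg_ge_cst (cvg_norm G0) _; apply: nearW => n.
  by case: (P n) => _ /negP; rewrite -ltNge => /ltW.
by rewrite lm (ph_diag phG) normr0 leNgt e0.
Qed.

(** For [y] near [x], growth at rate [c] forces [Gam x] to change sign along the orbit of [y]
    between times [- e'] and [e']. *)
Lemma theta_small e : 0 < e -> exists2 delta : R, 0 < delta &
  forall x y, d x y <= delta -> `|theta x y| <= e /\ Gam x (proj x y) = 0.
Proof.
move=> e0; pose e' := Num.min e (tau / 8).
have e'0 : 0 < e' by rewrite lt_min e0 divr_gt0.
have e'e : e' <= e by rewrite ge_min lexx.
have e'8 : e' <= tau / 8 by rewrite ge_min lexx orbT.
have [delta delta0 P] := phase_modulus (e := c * e') ltac:(by rewrite mulr_gt0).
exists (Num.min delta (r / 2)); first by rewrite lt_min delta0 divr_gt0.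
move=> x y; rewrite le_min => /andP[xy1 xy2].
have := P _ _ xy1; rewrite ler_norml => /andP[G1 G2].
have near_r t : `|t| <= e' -> d x (phi t y) <= r.
  by move=> te; apply: phase_near => //; plra.
have et : 0 <= e' <= tau by apply/andP; split; plra.
have h1 : 0 <= Gam x (phi e' y).
  by have := ph_incr phG (near_r 0 _) et; rewrite normr0 flow0// (ltW e'0) => /(_ isT); plra.
have h2 : Gam x (phi (- e') y) <= 0.
  have := ph_incr phG (near_r (- e') _) et.
  by rewrite normrN ger0_norm ?(ltW e'0)// flowNK// => /(_ (lexx _)); plra.
have cG : continuous (fun t => Gam x (phi t y)).
  by move=> t; apply: (ph_cvg phG); [exact: cvg_cst | apply: flow_cvg => //; exact: cvg_cst].
have ee : - e' <= e' by plra.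
have [|t] := @IVT R _ (- e') e' 0 ee (continuous_subspaceT cG).
  by rewrite ge_min h2 le_max h1 orbT.
rewrite in_itv /= -ler_norml => te Gt.
have tE : theta x y = t by apply: theta_eq => //; plra.
by rewrite /proj tE; split => //; plra.
Qed.

(** The limit of the bounded crossing times is a crossing time for the limit pair, hence equal to
    [theta l m] by uniqueness. The condition on [proj] excludes default values. *)
Lemma theta_cvg (x y : nat -> X) (l m : X) :
  x @ uoo --> l -> y @ uoo --> m -> d l m <= r / 2 ->
  (\forall n \near uoo, Gam (x n) (proj (x n) (y n)) = 0) ->
  (fun n => theta (x n) (y n)) @ uoo --> theta l m /\ Gam l (proj l m) = 0.
Proof.
move=> xl ym lm Gn.
have [t t8 tt] := ucvg_real (u := fun n => theta (x n) (y n)) (fun n => theta_le _ _).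
have h : (fun n => Gam (x n) (proj (x n) (y n))) @ uoo --> Gam l (phi t m).
  by apply: (ph_cvg phG) => //; exact: flow_cvg.
have h0 : (fun n => Gam (x n) (proj (x n) (y n))) @ uoo --> 0.
  exact: ucvg_near_cst.
have Gt : Gam l (phi t m) = 0 by exact: (cvg_unique _ h h0).
by rewrite /proj (theta_eq lm t8 Gt).
Qed.

Lemma step_small T e : 0 < e -> exists2 delta : R, 0 < delta &
  forall (p : X * X) s, `|s| <= T -> d p.1 p.2 <= delta -> inphase e (step s p) /\
    `|theta (phi s p.1) (phi s p.2)| <= e.
Proof.
move=> e0; have e2 : 0 < e / 2 by rewrite divr_gt0.
have [del1 del10 P1] := flow_modulus phiF cX 1 e2.
pose e' := Num.min (Num.min del1 1) e.
have e'0 : 0 < e' by rewrite !lt_min del10 e0 ltr01.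
have [e1 e2' e3] : [/\ e' <= del1, e' <= 1 & e' <= e].
  by split; rewrite /e' !ge_min lexx ?orbT.
have [del2 del20 P2] := theta_small e'0.
have del3 : 0 < Num.min del2 (e / 2) by rewrite lt_min del20.
have [del delP0 P3] := flow_modulus phiF cX T del3.
exists del => // p s s1 pd; set x := phi s p.1; set y := phi s p.2.
have : d x y <= Num.min del2 (e / 2).
  by apply: P3 => //; rewrite subrr normr0 ltW.
rewrite le_min => /andP[xy1 xy2].
have [th G0] := P2 _ _ xy1; split; last plra.
split => //=; rewrite -/x -/y.
have : d (phi 0 y) (proj x y) <= e / 2.
  apply: P1; rewrite ?mdistxx ?normr0 ?(ltW del10)//; first plra.
  by rewrite sub0r normrN; plra.
rewrite flow0//; have := metric_triangle x y (proj x y); plra.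
Qed.

(* Below this scale the correction [theta] exists and [step s], [step (- s)]
   are mutually inverse. *)
Definition step_scale (e : R) := [/\ 0 < e, e <= r / 2 &
  forall p s, inphase e p -> `|s| <= 1 ->
    [/\ inphase (r / 2) (step s p), d (phi s p.1) (phi s p.2) <= r / 2 &
        step (- s) (step s p) = p]].

Lemma step_scale_le e e' : step_scale e -> 0 < e' -> e' <= e -> step_scale e'.
Proof.
move=> [e0 er P] e'0 ee; split => //; first plra.
by move=> p s [G0 pd]; apply: P; split => //; plra.
Qed.

Lemma step_scale_exists : exists e, step_scale e.
Proof.
have r4 : 0 < r / 4 by rewrite divr_gt0.
have r20 : 0 < r / 2 by rewrite divr_gt0.
have [k k0 kP] := flow_modulus phiF cX tau r4.
pose e' := Num.min k (r / 2).
have e'0 : 0 < e' by rewrite lt_min k0.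
have [e1 e2] : e' <= k /\ e' <= r / 2 by split; rewrite /e' ge_min lexx ?orbT.
have [del del0 delP] := step_small 1 e'0.
have [del' del'0 del'P] := flow_modulus phiF cX 1 r20.
pose e := Num.min (Num.min del del') (r / 4).
have [ed ed' er] : [/\ e <= del, e <= del' & e <= r / 4].
  by split; rewrite /e !ge_min lexx ?orbT.
exists e; split; first by rewrite !lt_min del0 del'0.
  plra.
move=> p s [G0 pd] s1.
have [[G1 d1] th1] := delP p s s1 ltac:(plra).
split; first by split => //; plra.
- apply: del'P => //; last plra.
  by rewrite subrr normr0 ltW.
case: p G0 pd G1 d1 th1 => x y /= G0 pd G1 d1 th1; rewrite /step /= flowK//.
(* Flowing back leaves [y] displaced by the correction [theta], and by uniqueness the new correction
   is its opposite. *)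
have -> : phi (- s) (proj (phi s x) (phi s y)) = phi (theta (phi s x) (phi s y)) y.
  by rewrite /proj !flowD//; congr (phi _ y); ring.
set th := theta _ _ in th1 *.
have th8 : `|th| <= tau / 8 by exact: theta_le.
rewrite /proj (@theta_eq x _ (- th)) ?flowK// ?normrN//.
have : d (phi 0 y) (phi th y) <= r / 4.
  apply: kP; rewrite ?mdistxx ?normr0 ?(ltW tau0) ?(ltW k0)//; first plra.
  by rewrite sub0r normrN; plra.
by rewrite flow0//; have := metric_triangle x y (phi th y); plra.
Qed.

(** * Iterates of the step and expansivity *)

Definition pcvg (p : nat -> X * X) (q : X * X) :=
  (fun n => (p n).1) @ uoo --> q.1 /\ (fun n => (p n).2) @ uoo --> q.2.

Lemma inphase_pcvg e (p : nat -> X * X) q : pcvg p q ->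
  (\forall n \near uoo, inphase e (p n)) -> inphase e q.
Proof.
move=> [p1 p2] He; split.
  have h : (fun n => Gam (p n).1 (p n).2) @ uoo --> Gam q.1 q.2 by exact: (ph_cvg phG).
  apply: (cvg_unique _ h) => //.
  by apply: ucvg_near_cst; apply: filterS He => n [].
by apply: ucvg_le_cst (mdist_cvg p1 p2) _; apply: filterS He => n [].
Qed.

Lemma step_pcvg e s (p : nat -> X * X) q : step_scale e -> `|s| <= 1 ->
  pcvg p q -> (\forall n \near uoo, inphase e (p n)) ->
  pcvg (fun n => step s (p n)) (step s q).
Proof.
move=> [e0 er P] s1 pq He.
have Hq := inphase_pcvg pq He; case: pq => p1 p2.
have [_ dq _] := P _ _ Hq s1.
have h1 : (fun n => phi s (p n).1) @ uoo --> phi s q.1.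
  by apply: flow_cvg => //; exact: cvg_cst.
have h2 : (fun n => phi s (p n).2) @ uoo --> phi s q.2.
  by apply: flow_cvg => //; exact: cvg_cst.
split => //=; apply: flow_cvg => //.
have [] // := theta_cvg h1 h2 dq.
by apply: filterS He => n Hn; have [[]] := P _ _ Hn s1.
Qed.

(** The accumulated offset between the clocks of the two orbits, as [iter_stepE] shows. *)
Definition deviation s (p : X * X) (n : nat) : R :=
  \sum_(i < n) theta (phi s (iter i (step s) p).1) (phi s (iter i (step s) p).2).

Lemma deviationS s p n : deviation s p n.+1 = deviation s p n +
  theta (phi s (iter n (step s) p).1) (phi s (iter n (step s) p).2).
Proof. by rewrite /deviation big_ord_recr. Qed.

Lemma iter_stepE s p n : iter n (step s) p =
  (phi (s *+ n) p.1, phi (s *+ n + deviation s p n) p.2).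
Proof.
elim: n => [|n IH].
  by rewrite /deviation big_ord0 addr0 mulr0n !flow0//; case: p.
rewrite deviationS iterS {1}/step; congr pair.
  by rewrite IH /= flowD// mulrSr.
rewrite /proj /=; set th := theta _ _; rewrite IH /= !flowD// mulrSr.
by congr (phi _ _); move: (s *+ n) (deviation s p n) th => ? ? ?; ring.
Qed.

Definition two_sided_deviation p (i : int) : R :=
  match i with Posz n => deviation 1 p n | Negz n => deviation (- 1) p n.+1 end.

(** The deviations at integer times interpolate to a reparametrization in [Rep] that keeps the two
    orbits close. Expansivity puts [y] on the orbit of [x] at a short time, which is 0 because [y]
    is on the section at [x]. *)
Lemma expansive_inphase : expansive phi -> exists2 e, step_scale e &
  forall p : X * X, (forall n, inphase e (iter n (step 1) p)) ->
            (forall n, inphase e (iter n (step (- 1)) p)) -> p.1 = p.2.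
Proof.
move=> /(_ (tau / 2) ltac:(by rewrite divr_gt0))[del del0 delP].
have [k1 k10 k1P] := flow_modulus phiF cX 2 del0.
(* The bound 1/2 is what [lipschitz_Rep] requires; [k1] controls the orbits between integer
   times. *)
pose kap := Num.min k1 (1 / 2).
have kap0 : 0 < kap by rewrite lt_min k10; lra.
have [kk k2] : kap <= k1 /\ kap <= 1 / 2 by split; rewrite /kap ge_min lexx ?orbT.
have [e1 e10 e1P] := step_small 1 kap0.
have [e2 e2P] := step_scale_exists.
have [e20 _ _] := e2P.
pose e := Num.min (Num.min e1 k1) e2.
have e0 : 0 < e by rewrite !lt_min e10 k10 e20.
have [ee1 ek1 ee2] : [/\ e <= e1, e <= k1 & e <= e2].
  by split; rewrite /e !ge_min lexx ?orbT.
exists e; first exact: (step_scale_le e2P e0 ee2).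
move=> [x y] Hp Hm; set p := (x, y) in Hp Hm *; rewrite /=.
pose a := two_sided_deviation p.
have aH i : inphase e (phi i%:~R x, phi (i%:~R + a i) y).
  case: i => n.
    by have := Hp n; rewrite iter_stepE.
  have := Hm n.+1; rewrite iter_stepE /a /= NegzE mulrNz -pmulrn.
  by rewrite mulNrn.
have th_small s n : `|s| <= 1 -> inphase e (iter n (step s) p) ->
    `|theta (phi s (iter n (step s) p).1) (phi s (iter n (step s) p).2)| <= kap.
  by move=> s1 [_ h]; have [] // := e1P (iter n (step s) p) s s1 (le_trans h ee1).
have N1 : `|-1 : R| <= 1 by rewrite normrN normr1.
have aL (i : int) : `|a (i + 1) - a i| <= kap.
  case: i => n.
    rewrite -PoszD addn1 /a /= deviationS addrAC subrr add0r.
    by apply: th_small => //; rewrite normr1.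
  have -> : Negz n + 1 = - n%:Z by rewrite NegzE -addn1 PoszD opprD subrK.
  have -> : a (- n%:Z) = deviation (- 1) p n.
    by case: n => [|n] //; rewrite /a /= /deviation !big_ord0.
  rewrite /a /= deviationS opprD addrA subrr sub0r normrN.
  exact: th_small.
have a0 : a 0 = 0 by rewrite /a /= /deviation big_ord0.
have kL := interpolate_lipschitz aL.
have hRep : Rep (fun t => t + interpolate a t).
  apply: lipschitz_Rep; first by rewrite -[X in interpolate _ X]/(0%:~R) interpolate_int.
  move=> s t; apply: (le_trans (kL s t)).
  by have := normr_ge0 (s - t); nra.
have [] := delP x y _ hRep.
  move=> t; set i := Num.floor t.
  have /andP[i1 i2] := floor_itv t; rewrite -/i intrD in i1 i2.
  have -> : phi t x = phi (t - i%:~R) (phi i%:~R x).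
    by rewrite flowD//; congr (phi _ _); ring.
  have -> : phi (t + interpolate a t) y =
      phi (t - i%:~R + (interpolate a t - a i)) (phi (i%:~R + a i) y).
    by rewrite flowD//; congr (phi _ _); ring.
  have h := kL t i%:~R; rewrite interpolate_int in h.
  have h' : kap * `|t - i%:~R| <= kap.
    by rewrite ger0_norm ?subr_ge0// ler_piMr ?(ltW kap0)//; lra.
  have /andP[h1 h2] : - kap <= interpolate a t - a i <= kap by rewrite -ler_norml; lra.
  apply: k1P.
  - by rewrite ler_norml; lra.
  - by rewrite ler_norml; lra.
  - by rewrite ler_norml; lra.
  - by have [_ /=] := aH i; lra.
move=> s s2 ys; have [Gxy dxy] := Hp 0; rewrite /= in Gxy dxy.
suff s0 : s = 0 by rewrite ys s0 flow0.
apply: (phase_inj (x := x) (y := x)) => //.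
- by rewrite mdistxx; plra.
- by rewrite normr0; plra.
- by rewrite -ys Gxy flow0// (ph_diag phG).
Qed.

Definition expansive_scale e := step_scale e /\
  forall p : X * X, (forall n, inphase e (iter n (step 1) p)) ->
            (forall n, inphase e (iter n (step (- 1)) p)) -> p.1 = p.2.

Lemma iter_step_pcvg e s (p : nat -> X * X) q n : step_scale e -> `|s| <= 1 ->
  pcvg p q -> (forall i, (i < n)%N -> \forall k \near uoo, inphase e (iter i (step s) (p k))) ->
  pcvg (fun k => iter n (step s) (p k)) (iter n (step s) q).
Proof.
move=> eS s1 pq; elim: n => [//|n IH] H; rewrite iterS.
apply: (step_pcvg eS s1 (p := fun k => iter n (step s) (p k))).
  by apply: IH => i ni; apply: H; rewrite ltnS ltnW.
exact: H.
Qed.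

(** A finite-time form of expansivity: pairs violating it for every [N] converge to a nondiagonal
    pair that stays close forever. *)
Lemma expansive_shrink e del : expansive_scale e -> 0 < del -> exists N : nat,
  forall p : X * X, (forall i, (i <= N)%N -> inphase e (iter i (step 1) p)) ->
            (forall i, (i <= N)%N -> inphase e (iter i (step (- 1)) p)) -> d p.1 p.2 < del.
Proof.
move=> [eS eE] del0; apply: contrapT => H.
have /choice[p pP] : forall N : nat, exists p : X * X,
  [/\ forall i, (i <= N)%N -> inphase e (iter i (step 1) p),
      forall i, (i <= N)%N -> inphase e (iter i (step (- 1)) p) & del <= d p.1 p.2].
  move=> N; apply: contrapT => H'; apply: H; exists N => p h1 h2.
  by rewrite ltNge; apply/negP => h; apply: H'; exists p.
have [x xl] := ucvgX cX (fun n => (p n).1); have [y yl] := ucvgX cX (fun n => (p n).2).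
have pq : pcvg p (x, y) by [].
have lim s : `|s| <= 1 ->
    (forall N i, (i <= N)%N -> inphase e (iter i (step s) (p N))) ->
    forall n, inphase e (iter n (step s) (x, y)).
  move=> s1 Hs n.
  have near_i i : \forall k \near uoo, inphase e (iter i (step s) (p k)).
    by near=> k; apply: Hs; near: k; exact: uoo_ge.
  apply: (inphase_pcvg (iter_step_pcvg eS s1 pq (fun i _ => near_i i))).
  exact: near_i.
have : x = y.
  apply: (eE (x, y)); apply: lim; rewrite ?normrN ?normr1//.
    by move=> N i iN; case: (pP N) => + _ _; exact.
  by move=> N i iN; case: (pP N) => _ + _; exact.
move=> xy; have : del <= d x y.
  by apply: ucvg_ge_cst (mdist_cvg xl yl) _; apply: nearW => n; case: (pP n).
by rewrite xy mdistxx leNgt del0.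
Unshelve. all: by end_near. Qed.

Lemma iter_stepK e s p n : step_scale e -> `|s| <= 1 ->
  (forall i, (i < n)%N -> inphase e (iter i (step s) p)) ->
  forall m, (m <= n)%N -> iter m (step (- s)) (iter n (step s) p) = iter (n - m) (step s) p.
Proof.
move=> [_ _ eS] s1 H; elim=> [|m IH] mn; first by rewrite subn0.
rewrite iterS IH ?(ltnW mn)// -[(n - m)%N]prednK ?subn_gt0// iterS.
rewrite subnS.
have im : ((n - m).-1 < n)%N by rewrite prednK ?subn_gt0// leq_subr.
by have [_ _ ->] := eS _ s (H _ im) s1.
Qed.

Lemma iter_step_small N e : 0 < e -> exists2 del : R, 0 < del &
  forall (p : X * X) s, `|s| <= 1 -> d p.1 p.2 <= del -> Gam p.1 p.2 = 0 ->
  forall n, (n <= N)%N -> inphase e (iter n (step s) p).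
Proof.
move=> e0; elim: N => [|N [del1 del10 IH]].
  by exists e => // p s _ pd pG n; rewrite leqn0 => /eqP->; split.
have [del2 del20 P2] := step_small 1 del10.
exists (Num.min del2 e); first by rewrite lt_min del20.
move=> p s s1; rewrite le_min => /andP[h1 h2] G0 [|n] nN; first by split.
have [[G1 d1] _] := P2 p s s1 h1.
by rewrite iterSr; apply: IH.
Qed.

(** The first [N] iterates are small by continuity; every later one has [N] close iterates on both
    sides, so [expansive_shrink] applies to it. *)
Lemma expansive_contraction e s del : expansive_scale e -> s = 1 \/ s = -1 -> 0 < del ->
  exists2 del' : R, 0 < del' & forall p : X * X, d p.1 p.2 <= del' ->
    (forall n, inphase e (iter n (step s) p)) -> forall n, inphase del (iter n (step s) p).
Proof.
move=> eE spm del0; have [eS _] := eE; have [N NP] := expansive_shrink eE del0.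
have s1 : `|s| <= 1 by case: spm => ->; rewrite ?normrN normr1.
have [del' del'0 del'P] := iter_step_small N del0.
exists del' => // p pd Hp n.
have [nN|Nn] := leqP n N; first by apply: del'P => //; case: (Hp 0).
split; first by case: (Hp n).
have back i : (i <= N)%N -> inphase e (iter i (step (- s)) (iter n (step s) p)).
  by move=> iN; rewrite (iter_stepK eS s1) ?(leq_trans iN (ltnW Nn)).
have forw i : (i <= N)%N -> inphase e (iter i (step s) (iter n (step s) p)).
  by move=> iN; rewrite -iterD.
apply: ltW; apply: NP; case: spm => E; move: back forw; rewrite ?E ?opprK// => back forw.
Qed.

(** * Change of base point *)

Lemma proj_shift : exists2 kap : R, 0 < kap & forall x y t, d x y <= kap ->
  `|t| <= kap -> proj x (phi t y) = proj x y.
Proof.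
have t16 : 0 < tau / 16 by plra.
have r4 : 0 < r / 4 by plra.
have [k1 k10 k1P] := theta_small t16.
have [k2 k20 k2P] := flow_modulus phiF cX tau r4.
pose kap := Num.min (Num.min k1 k2) (Num.min (tau / 16) (r / 4)).
have kap0 : 0 < kap by rewrite !lt_min k10 k20 t16 r4.
have [kk1 kk2 kt kr] : [/\ kap <= k1, kap <= k2, kap <= tau / 16 & kap <= r / 4].
  by split; rewrite /kap !ge_min lexx ?orbT.
exists kap => // x y t xy tk.
have [th1 G0] := k1P x y (le_trans xy kk1).
have yty : d (phi 0 y) (phi t y) <= r / 4.
  apply: k2P; rewrite ?mdistxx ?normr0 ?(ltW k20) ?(ltW tau0)//; first by plra.
  by rewrite sub0r normrN; lra.
rewrite flow0// in yty.
(* Moving [y] by [t] along its orbit changes its crossing time by [- t], so the crossing point is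
   unchanged. *)
have E : phi (theta x y - t) (phi t y) = proj x y.
  by rewrite flowD//; congr (phi _ _); ring.
rewrite {1}/proj (theta_eq (t := theta x y - t))//.
- by have := metric_triangle x y (phi t y); lra.
- by have := ler_normB (theta x y) t; plra.
- by rewrite E.
Qed.

(* The pairs (x, p) and (x, y) are followed on the clock of x, whereas (p, proj p y)
   runs on the clock of p.  Its iterates are of the form [step (s * t) (p', y')],
   where p' and y' are companions of an iterate of x and t is the offset between the
   clocks; as soon as t > 2, advancing x by two steps brings t back to [0, 3]. *)
Definition pair_trace (good : X -> X -> Prop) s q := exists x p y t,
  [/\ good x p, good x y, 0 <= t <= 3 & q = step (s * t) (p, y)].

Lemma base_change e : 0 < e -> exists2 e1 : R, 0 < e1 & forall s (x p y : X),
  s = 1 \/ s = -1 ->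
  (forall n, inphase e1 (iter n (step s) (x, p))) ->
  (forall n, inphase e1 (iter n (step s) (x, y))) ->
  forall n, inphase e (iter n (step s) (p, proj p y)).
Proof.
move=> e0.
have [kap kap0 kapP] := proj_shift.
have [k1 k10 k1P] := flow_modulus phiF cX 4 kap0.
have [k2 k20 k2P] := step_small 4 e0.
pose m := Num.min (kap / 4) (1 / 4).
have m0 : 0 < m by rewrite lt_min divr_gt0//; lra.
have [mk m4] : m <= kap / 4 /\ m <= 1 / 4 by split; rewrite /m ge_min lexx ?orbT.
have [k3 k30 k3P] := step_small 1 m0.
have [k4 k40 k4P] := theta_small kap0.
have [k5 k50 k5P] := flow_modulus phiF cX 4 k40.
pose e1 := Num.min (Num.min (k1 / 2) (k2 / 2)) (Num.min k3 (k5 / 2)).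
have e10 : 0 < e1 by rewrite !lt_min k30 !divr_gt0.
have [e11 e12 e13 e15] : [/\ e1 <= k1 / 2, e1 <= k2 / 2, e1 <= k3 & e1 <= k5 / 2].
  by split; rewrite /e1 !ge_min lexx ?orbT.
exists e1 => // s x p y spm Gp Gy.
have ss : s * s = 1 by case: spm => ->; rewrite ?mulrNN mulr1.
have s1 : `|s| = 1 by case: spm => ->; rewrite ?normrN normr1.
pose good x' p' := forall n, inphase e1 (iter n (step s) (x', p')).
have goodd x' p' y' : good x' p' -> good x' y' -> d p' y' <= e1 + e1.
  move=> /(_ 0)[_ /= g1] /(_ 0)[_ /= g2]; apply: (le_trans (metric_triangle p' x' y')).
  by rewrite (metric_sym p' x') lerD.
have norms t : 0 <= t -> `|s * t| = t by move=> t0; rewrite normrM s1 mul1r ger0_norm.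
have AH q : pair_trace good s q -> inphase e q.
  move=> [x' [p' [y' [t [Gp' Gy' /andP[t0 t3] ->]]]]].
  have [] // := k2P (p', y') (s * t); first by rewrite norms//; lra.
  apply: (le_trans (goodd _ _ _ Gp' Gy')); lra.
have th_small x' p' n : good x' p' ->
    `|theta (phi s (iter n (step s) (x', p')).1) (phi s (iter n (step s) (x', p')).2)| <= m.
  move=> g; have [_ h] := g n.
  have [] // := k3P (iter n (step s) (x', p')) s; first by rewrite s1.
  exact: le_trans e13.
have dev2 x' p' : good x' p' ->
    `|deviation s (x', p') 2| <= 2 * m.
  move=> g; rewrite !deviationS /deviation big_ord0 add0r.
  apply: (le_trans (ler_normD _ _)).
  have := th_small x' p' 0 g; have := th_small x' p' 1 g; lra.
have Astep q : pair_trace good s q -> pair_trace good s (step s q).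
  move=> [x' [p' [y' [t [Gp' Gy' /andP[t0 t3] ->]]]]].
  have dpy := goodd _ _ _ Gp' Gy'.
  have tt4 : `|s * t + s| <= 4.
    rewrite -{2}[s]mulr1 -mulrDr norms; first by lra.
    by rewrite addr_ge0.
  have dQ : d (phi (s * t + s) p') (phi (s * t + s) y') <= kap.
    apply: k1P => //; first by rewrite subrr normr0 ltW.
    by apply: (le_trans dpy); lra.
  (* Two successive corrections amount to one, since by [proj_shift] the final projection does not
     see the first correction. *)
  have -> : step s (step (s * t) (p', y')) = step (s * t + s) (p', y').
    rewrite /step /= !flowD//; congr pair.
    set Q := phi (s * t + s) p' in dQ *.
    rewrite {2}/proj !flowD//.
    set th := theta _ _.
    have -> : phi (s * t + (th + s)) y' = phi th (phi (s * t + s) y').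
      by rewrite flowD//; congr (phi _ _); ring.
    rewrite [RHS](_ : _ = proj Q (phi (s * t + s) y')); last by rewrite /proj flowD.
    apply: kapP => //.
    have [] // := k4P (phi (s * t) p') (phi (s * t) y').
    have t4 : `|s * t| <= 4 by rewrite norms//; lra.
    apply: k5P => //; first by rewrite subrr normr0 ltW.
    by apply: (le_trans dpy); lra.
  have [t2|t2] := leP t 2.
    exists x', p', y', (t + 1); split => //; last by rewrite mulrDr mulr1.
    by apply/andP; split; lra.
  have Ep := iter_stepE s (x', p') 2.
  have Ey := iter_stepE s (x', y') 2.
  have dp := dev2 _ _ Gp'; have dy := dev2 _ _ Gy'.
  set a := deviation _ _ _ in Ep dp; set b := deviation _ _ _ in Ey dy.
  rewrite [fst _]/= [snd _]/= in Ep Ey.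
  set x2 := phi (s *+ 2) x' in Ep Ey.
  set p2 := phi _ p' in Ep; set y2 := phi _ y' in Ey.
  (* The offset grows by 1 with the step and drops by 2 with the advance of [x]; [s * a] accounts
     for the deviation of [p'] from the clock of [x]. *)
  exists x2, p2, y2, (t - 1 - s * a); split.
  - by move=> n; have := Gp' (n + 2)%N; rewrite iterD Ep.
  - by move=> n; have := Gy' (n + 2)%N; rewrite iterD Ey.
  - have : `|s * a| <= 2 * m by rewrite normrM s1 mul1r.
    rewrite ler_norml => /andP[sa1 sa2].
    by apply/andP; split; lra.
  rewrite /step /=.
  have -> : s * (t - 1 - s * a) = s * t - s - a.
    by rewrite !mulrBr mulrA ss mul1r mulr1.
  have -> : phi (s * t - s - a) p2 = phi (s * t + s) p'.
    by rewrite /p2 flowD//; congr (phi _ _); ring.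
  congr pair.
  have -> : phi (s * t - s - a) y2 = phi (b - a) (phi (s * t + s) y').
    by rewrite /y2 !flowD//; congr (phi _ _); ring.
  rewrite (kapP _ (phi (s * t + s) y') (b - a))//.
  by apply: (le_trans (ler_normB b a)); lra.
move=> n; apply: AH; elim: n => [|n IH]; last by rewrite iterS; exact: Astep.
exists x, p, y, 0; split => //; first by rewrite lexx; lra.
by rewrite mulr0 /step /= !flow0.
Qed.

(** If the distances [d p (proj p y)] tended to 0, the limits of [p] and [y] would be on one short
    orbit piece and both on the section at the limit of [x], hence equal. *)
Lemma proj_far del : 0 < del -> exists2 del' : R, 0 < del' & forall x (p : X) y,
  inphase (r / 4) (x, p) -> inphase (r / 4) (x, y) -> del <= d p y ->
  del' <= d p (proj p y).
Proof.
move=> del0; apply: ex_pos_harmonic => H.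
have /choice[x /choice[p /choice[y P]]] : forall n : nat, exists x (p : X) y,
   [/\ inphase (r / 4) (x, p), inphase (r / 4) (x, y), del <= d p y &
      d p (proj p y) <= harmonic n].
  move=> n; have := H n => /existsNP[x] /existsNP[p] /existsNP[y].
  move=> /not_implyP[h1] /not_implyP[h2] /not_implyP[h3] /negP.
  by rewrite -ltNge => /ltW h4; exists x, p, y.
have [x' xx] := ucvgX cX x; have [p' pp] := ucvgX cX p; have [y' yy] := ucvgX cX y.
have [t t8 tt] := ucvg_real (u := fun n => theta (p n) (y n)) (fun n => theta_le _ _).
have ep : p' = phi t y'.
  apply: ucvg_mdist0 pp (flow_cvg phiF tt yy) _.
  by apply: nearW => n; case: (P n).
have [Gp dp] : inphase (r / 4) (x', p').
  apply: (inphase_pcvg (p := fun n => (x n, p n))) => //.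
  by apply: nearW => n; case: (P n).
have [Gy dy] : inphase (r / 4) (x', y').
  apply: (inphase_pcvg (p := fun n => (x n, y n))) => //.
  by apply: nearW => n; case: (P n).
rewrite /= in Gp dp Gy dy.
have t0 : t = 0.
  apply: (phase_inj (x := x') (y := y')); rewrite ?normr0.
  - by plra.
  - by plra.
  - by plra.
  - by rewrite -ep Gp flow0.
have : del <= d p' y'.
  by apply: ucvg_ge_cst (mdist_cvg pp yy) _; apply: nearW => n; case: (P n).
by rewrite ep t0 flow0// mdistxx leNgt del0.
Qed.

Lemma proj_chained : exists2 kap : R, 0 < kap & forall x (p : X) D, well_chained x D -> D p ->
  (forall y, D y -> d p y <= kap) ->
  well_chained p (proj p @` D) /\ forall y, D y -> inphase (r / 2) (p, proj p y).
Proof.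
have r4 : 0 < r / 4 by plra.
have [k0 k00 k0P] := flow_modulus phiF cX tau r4.
have t16 : 0 < Num.min (tau / 16) k0 by rewrite lt_min k00; plra.
have [k1 k10 k1P] := theta_small t16.
exists (Num.min k1 (r / 4)); first by rewrite lt_min k10; plra.
move=> x p D xD Dp Dk; split; last first.
  move=> y /Dk; rewrite le_min => /andP[/k1P[+ G0] py].
  rewrite le_min => /andP[th1 th2]; split => //=.
  have : d (phi 0 y) (proj p y) <= r / 4.
    apply: k0P; rewrite ?mdistxx ?normr0 ?(ltW k00) ?(ltW tau0)//; first by plra.
    by rewrite sub0r normrN.
  by rewrite flow0//; have := metric_triangle p y (proj p y); lra.
rewrite -{1}(proj_diag p).
apply: (well_chained_image cX); first exact: well_chained_base xD Dp.
move=> y l Dy yl.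
have Dl : D l by case: xD => cD _ _; apply: closed_ucvg cD _ yl; exact: nearW.
have := Dk _ Dl; rewrite le_min => /andP[_ pl].
have pl2 : d p l <= r / 2 by plra.
apply: flow_cvg => //.
have [] // := theta_cvg (cvg_cst p) yl pl2.
by apply: nearW => n; have := Dk _ (Dy n); rewrite le_min => /andP[/k1P[]].
Qed.

Lemma iter_step_diag s x n : iter n (step s) (x, x) = (phi (s *+ n) x, phi (s *+ n) x).
Proof.
elim: n => [|n IH]; first by rewrite mulr0n !flow0.
by rewrite iterS IH /step /= (proj_diag) flowD// mulrSr.
Qed.

Lemma iter_step_chained e s x D n : step_scale e -> `|s| <= 1 -> well_chained x D ->
  (forall i y, (i < n)%N -> D y -> inphase e (iter i (step s) (x, y))) ->
  well_chained (phi (s *+ n) x) ((fun y => (iter n (step s) (x, y)).2) @` D).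
Proof.
move=> eS s1 xD H; have := iter_step_diag s x n => /(congr1 snd) /= <-.
apply: (well_chained_image cX (f := fun y => (iter n (step s) (x, y)).2)) => //.
move=> y l Dy yl.
have [] // := iter_step_pcvg (q := (x, l)) (p := fun k => (x, y k)) (n := n) eS s1.
  by split => //=; exact: cvg_cst.
by move=> i ni; apply: nearW => k; exact: H.
Qed.

Lemma section_inj x y t : inphase (r / 2) (x, y) -> inphase (r / 2) (x, phi t y) ->
  `|t| <= tau / 2 -> t = 0.
Proof.
move=> [Gy dy] [Gt dt] t2; apply: (phase_inj (x := x) (y := y)) => //.
  by rewrite normr0; plra.
by rewrite flow0//; exact: etrans Gt (esym Gy).
Qed.

(** Flowing [D] for time [tau / 8] gives a strip in [K]. Its opposite sides are disjoint, because a
    short orbit piece meets the section at [x] only once. *)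
Lemma cover_dim1_no_transverse (K D : set X) x y : compact K -> cover_dim_le K 1 ->
  flow_invariant phi K -> well_chained x D -> D `<=` K ->
  (forall z, D z -> inphase (r / 2) (x, z)) -> D y -> y = x.
Proof.
move=> cK dK invK xD DK Dph Dy; apply: contrapT => nyx.
have Dx : D x by case: xD.
apply: (cover_dim1_strip phiF cX cK dK (a := tau / 8) _ xD Dy); first by plra.
- by move=> z t /DK Kz _; rewrite -(invK t); exists z.
- move=> s t /andP[s0 s8] /andP[t0 t8] e; apply: nyx.
  have yE : y = phi (s - t) x by rewrite -[LHS](flowK phiF t) -e flowD.
  rewrite yE (@section_inj x x (s - t)) ?flow0//.
  + exact: Dph.
  + by rewrite -yE; exact: Dph.
  + by rewrite ler_norml; plra.
- move=> z w Dz Dw e.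
  have : tau / 8 = 0.
    apply: (@section_inj x w); first exact: Dph.
      by rewrite -e; exact: Dph.
    by rewrite ger0_norm; plra.
  by plra.
Qed.

(** * Flow boxes and the dimension of the space *)

Definition transversal x (rho : R) : set X := [set y | inphase rho (x, y)].
Definition flow_box x (rho a : R) : set X :=
  [set z | exists y t, [/\ transversal x rho y, `|t| <= a & z = phi t y]].

Lemma closed_transversal x rho : closed (transversal x rho).
Proof.
apply: ucvg_closed => y l Hy yl.
apply: (inphase_pcvg (p := fun n => (x, y n))); last by apply: nearW.
by split => //=; exact: cvg_cst.
Qed.

Lemma closed_flow_box x rho a : closed (flow_box x rho a).
Proof.
apply: ucvg_closed => z l /choice[y /choice[t P]] zl.
have [l' yl] := ucvgX cX y.
have [t' ta tt] := ucvg_real (u := t) (M := a) ltac:(by move=> n; case: (P n)).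
exists l', t'; split => //.
  by apply: closed_ucvg (@closed_transversal x rho) _ yl; apply: nearW => n; case: (P n).
apply: ucvg_unique zl _.
rewrite (_ : z = fun n => phi (t n) (y n)); first exact: flow_cvg.
by apply/funext => n; case: (P n).
Qed.

Lemma flow_box_nbhs rho a : 0 < rho -> 0 < a -> exists2 del : R, 0 < del &
  forall x z, d x z <= del -> flow_box x rho a z.
Proof.
move=> rho0 a0; pose e := Num.min rho a.
have e0 : 0 < e by rewrite lt_min rho0.
have [e1 e2] : e <= rho /\ e <= a by split; rewrite /e ge_min lexx ?orbT.
have [del del0 P] := step_small 0 e0.
exists del => // x z xz.
have [] := P (x, z) 0; rewrite ?normr0 // /step /= !flow0// => -[G0 d0] th.
exists (proj x z), (- theta x z); split.
- by split => //=; exact: (le_trans d0 e1).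
- by rewrite normrN (le_trans th).
- by rewrite /proj flowK.
Qed.

(** Without nontrivial continua, the chain classes of a fine mesh are small and cut the section into
    finitely many separated pieces. Their products with overlapping time intervals give a refinement
    of order at most 2. *)
Lemma cover_dim1_flow_box x (rho a : R) : 0 < rho -> rho <= r / 2 -> 0 < a -> a <= tau / 8 ->
  (forall p D, well_chained p D -> D `<=` transversal x rho -> forall q, D q -> q = p) ->
  cover_dim_le (flow_box x rho a) 1.
Proof.
move=> rho0 rhor a0 atau trivD.
pose S := transversal x rho; pose Q := flow_box x rho a.
have cQ : compact Q by exact: subclosed_compact (@closed_flow_box x rho a) cX _.
have cS : compact S by exact: subclosed_compact (@closed_transversal x rho) cX _.
have Qx : Q x.
  exists x, 0; split => //; last by rewrite flow0.
    by split => /=; [exact: (ph_diag phG) | rewrite mdistxx ltW].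
  by rewrite normr0 ltW.
have Qinj y z s t : S y -> S z -> `|s| <= a -> `|t| <= a -> phi s y = phi t z ->
    y = z /\ s = t.
  move=> Sy Sz sa ta e.
  have yE : y = phi (t - s) z by rewrite -[LHS](flowK phiF s) e flowD.
  have ts : t - s = 0.
    have le2 w : S w -> inphase (r / 2) (x, w) by move=> [G0 dw]; split => //; exact: (le_trans dw rhor).
    apply: (@section_inj x z); [exact: le2 | by rewrite -yE; exact: le2 |].
    by have := ler_normB t s; plra.
  by split; [rewrite yE ts flow0 | lra].
apply: cover_dim_le_finType => k U oU QU.
have [lam lam0 lamP] := lebesgue_number cQ oU QU.
have lam2 : 0 < lam / 2 by rewrite divr_gt0.
have [mu mu0 muP] := flow_modulus phiF cX a lam2.
have [N NP] : exists N : nat, forall y z, S y -> chained S (harmonic N) y z -> d y z < mu.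
  apply: contrapT => H.
  have [|p [D [pD DS [q Dq pq]]]] := @well_chained_of_chains _ _ cX S mu (@closed_transversal x rho).
    move=> n; apply: contrapT => H'; apply: H; exists n => y z Sy yz.
    by rewrite ltNge; apply/negP => h; apply: H'; exists y, z.
  by have := trivD p D pD DS q Dq => qp; rewrite qp mdistxx leNgt mu0 in pq.
pose eta : R := harmonic N; have eta0 : 0 < eta by exact: harmonic_gt0.
have [m [net [netS netP]]] := compact_net cS eta0.
(* Each chain class is indexed by the least net point in it, which makes the pieces disjoint. *)
pose cls (i : 'I_m) : set X := [set z | [/\ S z, chained S eta (net i) z &
  forall i' : 'I_m, (i' < i)%N -> ~ chained S eta (net i') z]].
have cls_cover z : S z -> exists i, cls i z.
  move=> Sz.
  have [i0 i0P] : exists i : 'I_m, `[< chained S eta (net i) z >].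
    have [i iz] := netP _ Sz; exists i; apply/asboolP.
    exact: (chained_step (@chained_refl _ _ S eta (net i)) Sz (ltW iz)).
  case: (@arg_minnP _ i0 (fun i => `[< chained S eta (net i) z >]) (fun i => nat_of_ord i) i0P).
  move=> i /asboolP iz imin; exists i; split => // i' i'i /asboolP/imin.
  by rewrite leqNgt i'i.
have cls_disj i j z : cls i z -> cls j z -> i = j.
  move=> [_ iz imin] [_ jz jmin]; apply: val_inj => /=.
  by case: (ltngtP i j) => // [/jmin|/imin].
have cls_open i y z : cls i y -> S z -> d y z <= eta -> cls i z.
  move=> [Sy iy imin] Sz yz; split => //; first exact: (chained_step iy Sz yz).
  move=> i' i'i i'z; apply: (imin i' i'i).
  by apply: (chained_step i'z Sy); rewrite metric_sym.
have cls_small i y z : cls i y -> cls i z -> d y z <= mu.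
  move=> [Sy iy _] [Sz iz _]; apply: ltW; apply: NP => //.
  exact: (chained_trans (chained_sym (netS i) iy) iz).
pose w := mu / 2; have w0 : 0 < w by rewrite divr_gt0.
pose M := (Num.bound (2 * a / w)).+1.
pose J (l : 'I_M) (t : R) := `|t + a - l%:R * w| < w.
have J_cover t : `|t| <= a -> exists l, J l t.
  rewrite ler_norml => /andP[t1 t2].
  have u0 : 0 <= (t + a) / w by apply: divr_ge0; [lra | exact: ltW].
  have /andP[l1 l2] := floor_itv ((t + a) / w).
  have [l lE] : exists l : nat, Num.floor ((t + a) / w) = l%:Z.
    by exists (absz (Num.floor ((t + a) / w))); rewrite gez0_abs// floor_ge0.
  rewrite lE in l1 l2; rewrite intrD in l2.
  have lM : (l < M)%N.
    rewrite ltnS -(ler_nat R).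
    apply: (le_trans l1); apply: ltW.
    apply: le_lt_trans (archi_boundP _); last by rewrite divr_ge0 ?mulr_ge0// ltW.
    by rewrite ler_pM2r ?invr_gt0//; lra.
  exists (Ordinal lM); rewrite /J /= ltr_norml.
  move: l1 l2; rewrite ler_pdivlMr// ltr_pdivrMr// mulrDl mul1r.
  by move=> l1 l2; apply/andP; split; rewrite -?[l%:R]/(l%:~R); lra.
have J_two t : exists f : int, forall l, J l t -> l%:Z = f \/ l%:Z = f + 1.
  exists (Num.floor ((t + a) / w)) => l; rewrite /J ltr_norml => /andP[h1 h2].
  have /andP[f1 f2] := floor_itv ((t + a) / w).
  set f := Num.floor _ in f1 f2 *.
  rewrite ler_pdivlMr// in f1; rewrite ltr_pdivrMr// in f2.
  have g1 : f < l%:Z + 1.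
    rewrite -(ltr_int R) intrD -(ltr_pM2r w0) mulrDl mul1r.
    by apply: (le_lt_trans f1); rewrite -[l%:~R]/(l%:R); lra.
  have g2 : l%:Z < f + 1 + 1.
    rewrite -(ltr_int R) [(f + 1 + 1)%:~R]intrD -(ltr_pM2r w0) [X in _ < X]mulrDl mul1r.
    by rewrite -[l%:~R]/(l%:R); lra.
  exact: int_between.
(* The part of the box off the piece [cls i] times [J l] is closed, so removing it from an open set
   of the cover leaves an open set. *)
pose F i l : set X := [set q | exists z t, [/\ S z, `|t| <= a, ~ (cls i z /\ J l t) & q = phi t z]].
have F_closed i l : closed (F i l).
  apply: ucvg_closed => q q' /choice[z /choice[t P]] qq.
  have [z' zz] := ucvgX cX z.
  have [t' ta tt] := ucvg_real (u := t) (M := a) ltac:(by move=> n; case: (P n)).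
  have Sz' : S z'.
    by apply: closed_ucvg (@closed_transversal x rho) _ zz; apply: nearW => n; case: (P n).
  exists z', t'; split => //; last first.
    apply: ucvg_unique qq _.
    rewrite (_ : q = fun n => phi (t n) (z n)); first exact: flow_cvg.
    by apply/funext => n; case: (P n).
  move=> [cz Jt].
  have h2 : \forall n \near uoo, J l (t n).
    have gap : 0 < w - `|t' + a - l%:R * w| by rewrite subr_gt0.
    move/cvgrPdist_lt : tt => /(_ _ gap); apply: filterS => n h; rewrite /J.
    have -> : t n + a - l%:R * w = (t' + a - l%:R * w) - (t' - t n) by ring.
    by apply: le_lt_trans (ler_normB _ _) _; lra.
  have [n [h1 Jn]] := filter_ex (filterI (ucvg_dist_lt zz eta0) h2).
  have [Szn _ nP _] := P n; apply: nP; split => //.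
  by apply: cls_open cz Szn (ltW h1).
(* A default index for empty pieces. *)
have [j0 _ _] := QU _ Qx.
have /choice[g gP] : forall il : 'I_m * 'I_M, exists j, forall z t,
    cls il.1 z -> `|t| <= a -> J il.2 t -> U j (phi t z).
  move=> [i l] /=.
  case: (pselect (exists z t, [/\ cls i z, `|t| <= a & J l t])); last first.
    by move=> nE; exists j0 => z t iz ta lt; case: nE; exists z, t.
  move=> [z [t [iz ta lt]]].
  have [|j jP] := lamP (phi t z); first by exists z, t; split => //; case: iz.
  exists j => z' t' iz' ta' lt'; apply: jP.
  apply: (@le_lt_trans _ _ (lam / 2)); last by lra.
  apply: muP => //; last exact: cls_small iz iz'.
  have -> : t - t' = (t + a - l%:R * w) - (t' + a - l%:R * w) by ring.
  apply: (le_trans (ler_normB _ _)); move: lt lt'; rewrite /J /w; lra.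
exists ('I_m * 'I_M)%type, (fun il => U (g il) `&` ~` F il.1 il.2); split.
- by move=> il; apply: openI => //; exact: closed_openC.
- move=> _ [z [t [Sz ta ->]]].
  have [i iz] := cls_cover _ Sz; have [l lt] := J_cover _ ta.
  exists (i, l) => //=; split; first exact: gP.
  move=> [z' [t' [Sz' ta' nP e]]].
  by have [ez et] := Qinj _ _ _ _ Sz Sz' ta ta' e; apply: nP; rewrite -ez -et.
- by move=> il; exists (g il) => q [].
- move=> _ [z [t [Sz ta ->]]].
  have [i iz] := cls_cover _ Sz; have [f fP] := J_two t.
  have key il : (U (g il) `&` ~` F il.1 il.2) (phi t z) -> il.1 = i /\ J il.2 t.
    move=> [_ nF]; have [cz Jt] : cls il.1 z /\ J il.2 t.
      by apply: contrapT => nP; apply: nF; exists z, t.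
    by split => //; exact: cls_disj cz iz.
  pose V il := (U (g il) `&` ~` F il.1 il.2) (phi t z).
  pose B := [set il : 'I_m * 'I_M | `[< V il >]].
  rewrite -[X in (X <= _)%N]/(#|B|).
  have : (#|[set il.2 | il in B]%SET| <= 2)%N.
    pose L := [set l : 'I_M | (l%:Z == f) || (l%:Z == f + 1)]%SET.
    have BL : [set il.2 | il in B]%SET \subset L.
      apply/fintype.subsetP => _ /imsetP[il + ->]; rewrite !inE => /asboolP/key[_ /fP[]->];
        by rewrite eqxx ?orbT.
    apply: leq_trans (subset_leq_card BL) _.
    rewrite cardE -(size_map (fun l : 'I_M => l%:Z)).
    apply: (@uniq_leq_size _ _ [:: f; f + 1]).
      by rewrite map_inj_uniq ?enum_uniq// => l1 l2 [] /val_inj.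
    by move=> _ /mapP[l + ->]; rewrite mem_enum !inE.
  apply: leq_trans; rewrite card_in_imset// => il1 il2; rewrite !inE.
  by move=> /asboolP/key[e1 _] /asboolP/key[e2 _] e; case: il1 il2 e1 e2 e => [? ?] [? ?] /= -> -> ->.
Qed.

(** Otherwise all small flow boxes would have dimension at most 1, and finitely many of them cover
    the space. A continuum in a box is first projected to the section at one of its own points. *)
Lemma small_transverse_exists e : ~ cover_dim_le [set: X] 1 -> 0 < e ->
  exists x D, [/\ well_chained x D, forall y, D y -> inphase e (x, y) &
    exists2 y, D y & y <> x].
Proof.
move=> ndim e0; apply: contrapT => H; apply: ndim.
have [del del0 delP] := step_small 0 e0.
have [kap kap0 kapP] := proj_chained.
pose rho := Num.min (Num.min (del / 2) (kap / 2)) (r / 2).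
have rho0 : 0 < rho by rewrite !lt_min !divr_gt0.
have [rd rk rr] : [/\ rho <= del / 2, rho <= kap / 2 & rho <= r / 2].
  by split; rewrite /rho !ge_min lexx ?orbT.
have t8 : 0 < tau / 8 by plra.
have box_dim x : cover_dim_le (flow_box x rho (tau / 8)) 1.
  apply: cover_dim1_flow_box => // p D pD DS q Dq.
  have Dp : D p by case: pD.
  have dp y : D y -> d p y <= rho + rho.
    move=> /DS[_ /= xy]; have [_ /= xp] := DS _ Dp.
    by apply: le_trans (metric_triangle p x y) _; rewrite (metric_sym p x) lerD.
  have [|wp _] := kapP p p D pD Dp; first by move=> y /dp; lra.
  have pq : proj p q = p.
    apply: contrapT => npq; apply: H; exists p, (proj p @` D); split => //.
      move=> _ [y Dy <-]; have [] := delP (p, y) 0; rewrite ?normr0//.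
        by have := dp _ Dy => /=; lra.
      by rewrite /step /= !flow0.
    by exists (proj p q) => //; exists q.
  have inph y : D y -> inphase (r / 2) (x, y).
    by move=> /DS[G0 /= dy]; split => //=; exact: (le_trans dy rr).
  have th0 : theta p q = 0.
    apply: (@section_inj x q); [exact: inph | |].
      by rewrite -/(proj p q) pq; exact: inph.
    by have := theta_le p q; plra.
  by rewrite -pq /proj th0 flow0.
have [kp kp0 kpP] := flow_box_nbhs rho0 t8.
have [k [s [_ sP]]] := compact_net cX kp0.
pose A n := if insub n is Some i then flow_box (s i) rho (tau / 8) else set0.
have -> : [set: X] = \big[setU/set0]_(i < k) A i.
  apply/esym/seteqP; split => // z _; have [i iz] := sP z I.
  have : A i z by rewrite /A valK; exact: kpP (ltW iz).
  by rewrite -bigcup_mkord => Az; exists (nat_of_ord i) => //=.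
apply: cover_dim_le_bigsetU => n; rewrite /A; case: insub => // *.
- exact: closed_flow_box.
- exact: closed0.
- exact: cover_dim_le_set0.
Qed.

Lemma inphase_le e e' (p : X * X) : e <= e' -> inphase e p -> inphase e' p.
Proof. by move=> ee [G0 dp]; split => //; exact: le_trans ee. Qed.

(** Continua of definite size in ever thinner neighbourhoods of [K] would converge to a nontrivial
    transverse continuum inside [K]. *)
Lemma transverse_escapes (K : set X) (e e' : R) : compact K -> flow_invariant phi K ->
  cover_dim_le K 1 -> e <= r / 2 -> 0 < e' ->
  exists2 rho : R, 0 < rho & forall x D, well_chained x D ->
    (forall y, D y -> inphase e (x, y)) -> (exists2 y, D y & e' <= d x y) ->
    exists2 p, D p & forall k, K k -> rho <= d p k.
Proof.
move=> cK invK dimK er e'0; apply: ex_pos_harmonic => H.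
have /choice[x /choice[D P]] : forall n : nat, exists x D, [/\ well_chained x D,
    forall y, D y -> inphase e (x, y), exists2 y, D y & e' <= d x y &
    forall p, D p -> exists2 k, K k & d p k <= harmonic n].
  move=> n; have := H n => /existsNP[x] /existsNP[D] /not_implyP[h1] /not_implyP[h2].
  move=> /not_implyP[h3 h4]; exists x, D; split => // p Dp; apply: contrapT => h5.
  apply: h4; exists p => // k Kk; rewrite leNgt; apply/negP => h6; apply: h5.
  by exists k => //; exact: ltW.
have [l xl] := ucvgX cX x.
have Dx n : D n (x n) by have [[]] := P n.
have Dne n : D n !=set0 by exists (x n).
have lL : well_chained l (ulimset D).
  apply: (well_chained_ulimset cX Dx xl (@uoo_harmonic R)) => n y Dy.
  by have [[_ _ wD] _ _ _] := P n; apply: wD => //; exact: harmonic_gt0.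
have LK : ulimset D `<=` K.
  move=> z /(ulimset_seq Dne)[w Dw wz].
  have /choice[k kP] : forall n, exists k, K k /\ d (w n) k <= harmonic n.
    by move=> n; have [_ _ _ /(_ _ (Dw n))[k Kk kw]] := P n; exists k.
  have [k' Kk' kk] := ucvg_compact cK (x := k) (fun n => proj1 (kP n)).
  have -> : z = k'; last by [].
  by apply: ucvg_mdist0 wz kk _; apply: nearW => n; case: (kP n).
have Lph z : ulimset D z -> inphase (r / 2) (l, z).
  move=> /(ulimset_seq Dne)[w Dw wz]; apply: (inphase_le er).
  apply: (inphase_pcvg (p := fun n => (x n, w n))) => //.
  by apply: nearW => n; have [_ /(_ _ (Dw n))] := P n.
have /choice[y yP] : forall n, exists y, D n y /\ e' <= d (x n) y.
  by move=> n; have [_ _ [y Dy xy] _] := P n; exists y.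
have [m ym] := ucvgX cX y.
have Lm : ulimset D m by apply: ulimset_mem ym; apply: nearW => n; case: (yP n).
have ml := cover_dim1_no_transverse cK dimK invK lL LK Lph Lm.
have : e' <= d l m.
  by apply: ucvg_ge_cst (mdist_cvg xl ym) _; apply: nearW => n; case: (yP n).
by rewrite ml mdistxx leNgt e'0.
Qed.

(** * Growth and renewal of unstable continua *)

Definition sign s := s = 1 \/ s = -1.

Lemma sign_norm s : sign s -> `|s| <= 1.
Proof. by case=> ->; rewrite ?normrN normr1. Qed.

Lemma signN s : sign s -> sign (- s).
Proof. by case=> ->; [right | left; rewrite opprK]. Qed.

(* D is a nondegenerate continuum in the cross section at x whose points stay
   close to x under all iterates of the flow in the direction s. *)
Definition unstable s e e' x D := [/\ well_chained x D,
  forall y, D y -> forall n, inphase e (iter n (step s) (x, y)) &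
  exists2 y, D y & e' <= d x y].

(** [e0] is the scale of expansivity, [e2] the size at which growth is stopped, and [e1] bounds what
    one more step makes of a pair at scale [e2]. *)
Context {e0 e1 e2 : R}.
Hypothesis exp0 : expansive_scale e0.
Hypothesis e20 : 0 < e2.
Hypothesis e21 : e2 <= e1.
Hypothesis e10 : e1 <= e0.
Hypothesis one_step : forall (p : X * X) s, `|s| <= 1 -> inphase e2 p -> inphase e1 (step s p).

Lemma first_exit s x D n : sign s -> well_chained x D -> (0 < n)%N ->
  (forall i y, (i < n)%N -> D y -> inphase e2 (iter i (step s) (x, y))) ->
  (exists2 y, D y & ~ inphase e2 (iter n (step s) (x, y))) ->
  let D' := (fun y => (iter n (step s) (x, y)).2) @` D in
  let x' := phi (s *+ n) x in
  [/\ well_chained x' D', exists2 y', D' y' & e2 <= d x' y' &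
     forall y, D y -> let y' := (iter n (step s) (x, y)).2 in inphase e1 (x', y') /\
       forall i, (i <= n)%N -> iter i (step (- s)) (x', y') = iter (n - i) (step s) (x, y)].
Proof.
move=> sg xD n0 Dn [z Dz nz] D' x'; have [eS _] := exp0.
have s1 := sign_norm sg.
have pairE y : (x', (iter n (step s) (x, y)).2) = iter n (step s) (x, y).
  by rewrite (iter_stepE).
have in0 i y : (i < n)%N -> D y -> inphase e0 (iter i (step s) (x, y)).
  by move=> ni Dy; apply: inphase_le (Dn _ _ ni Dy); exact: le_trans e10.
have ine1 y : D y -> inphase e1 (iter n (step s) (x, y)).
  move=> Dy; rewrite -(prednK n0) iterS; apply: one_step => //.
  by apply: Dn => //; rewrite prednK.
split.
- exact: (iter_step_chained eS s1 xD in0).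
- exists (iter n (step s) (x, z)).2; first by exists z.
  rewrite leNgt; apply/negP => h; apply: nz.
  have [G0 _] := ine1 _ Dz; split => //.
  by rewrite -pairE ltW.
- move=> y Dy /=; rewrite pairE; split; first exact: ine1.
  by move=> i ni; apply: (iter_stepK eS s1) => // j jn; exact: in0.
Qed.

Definition long_unstable s := forall m : nat, exists x D, [/\ well_chained x D,
  forall y, D y -> forall i, (i <= m)%N -> inphase e1 (iter i (step s) (x, y)) &
  exists2 y, D y & e2 <= d x y].

(** By expansivity a tiny continuum exceeds the size [e2] in one direction [s], and only after more
    than [m] steps. Its image at the first exit stays small for [m] steps in the direction [- s]. *)
Lemma long_unstable_exists : ~ cover_dim_le [set: X] 1 ->
  long_unstable 1 \/ long_unstable (- 1).
Proof.
move=> ndim; apply: contrapT => /not_orP[/existsNP[m1 nm1] /existsNP[m2 nm2]].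
pose m := maxn m1 m2.
have fail s : sign s -> ~ exists x D, [/\ well_chained x D,
    forall y, D y -> forall i, (i <= m)%N -> inphase e1 (iter i (step s) (x, y)) &
    exists2 y, D y & e2 <= d x y].
  move=> [->|->] [x [D [wD h1 h2]]]; [apply: nm1|apply: nm2]; exists x, D; split => //;
    move=> y Dy i im; apply: h1 => //; apply: leq_trans im _; rewrite /m leq_max leqnn ?orbT//.
have [del del0 delP] := iter_step_small m.+1 e20.
have [x [D [xD Dph [y Dy nyx]]]] := small_transverse_exists ndim del0.
pose bad n := `[< exists s y, [/\ sign s, D y & ~ inphase e2 (iter n (step s) (x, y))] >].
have exbad : exists n, bad n.
  apply: contrapT => nbad; apply: nyx; apply/esym.
  have all_in s n : sign s -> inphase e0 (iter n (step s) (x, y)).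
    move=> sg; apply: contrapT => h; apply: nbad; exists n; apply/asboolP; exists s, y.
    split => // h'; apply: h; apply: inphase_le h'; exact: le_trans e10.
  by apply: (exp0.2 (x, y)) => n; apply: all_in; [left|right].
case: (ex_minnP exbad) => n /asboolP[s [z [sg Dz nz]]] nmin.
have good i w : (i < n)%N -> D w -> inphase e2 (iter i (step s) (x, w)).
  move=> ni Dw; apply: contrapT => h; have : bad i by apply/asboolP; exists s, w.
  by move=> /nmin; rewrite leqNgt ni.
have mn : (m.+1 < n)%N.
  rewrite ltnNge; apply/negP => nm; apply: nz.
  have [G0 dz] := Dph _ Dz.
  by apply: delP => //; exact: sign_norm.
have n0 : (0 < n)%N by exact: leq_ltn_trans mn.
have [wD' far DP] := first_exit sg xD n0 good (ex_intro2 _ _ z Dz nz).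
apply: (fail (- s) (signN sg)).
exists (phi (s *+ n) x), ((fun y => (iter n (step s) (x, y)).2) @` D); split => //.
move=> _ [w Dw <-] i im; have [ine1 back] := DP _ Dw.
have iln : (i <= n)%N by exact: leq_trans (leqW (leqW im)) mn.
(* At the exit itself only the bound [e1] holds; the other iterates precede the exit and satisfy
   [e2]. *)
case: i im iln => [|i] im iln; first exact: ine1.
rewrite back//; apply: inphase_le e21 _; apply: good => //.
by rewrite ltn_subrL n0.
Qed.

Lemma unstable_exists : ~ cover_dim_le [set: X] 1 ->
  exists s x D, sign s /\ unstable s e1 e2 x D.
Proof.
have [eS _] := exp0.
have lim s : sign s -> long_unstable s -> exists x D, unstable s e1 e2 x D.
  move=> sg; move=> /choice[x /choice[D P]].
  have [l xl] := ucvgX cX x.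
  have Dx n : D n (x n) by have [[]] := P n.
  have Dne n : D n !=set0 by exists (x n).
  exists l, (ulimset D); split.
  - apply: (well_chained_ulimset cX Dx xl (@uoo_harmonic R)) => n y Dy.
    by have [[_ _ wD] _ _] := P n; apply: wD => //; exact: harmonic_gt0.
  - move=> z /(ulimset_seq Dne)[w Dw wz] i.
    have near_i j : \forall k \near uoo, inphase e1 (iter j (step s) (x k, w k)).
      by near=> k; have [_ /(_ _ (Dw k)) h _] := P k; apply: h; near: k; exact: uoo_ge.
    have e1S : step_scale e1 by apply: (step_scale_le eS) e10; exact: lt_le_trans e21.
    have pq : pcvg (fun k => (x k, w k)) (l, z) by [].
    have := iter_step_pcvg e1S (sign_norm sg) pq (fun j (_ : (j < i)%N) => near_i j).
    by move=> h; apply: (inphase_pcvg h); exact: near_i.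
  - have /choice[y yP] : forall n, exists y, D n y /\ e2 <= d (x n) y.
      by move=> n; have [_ _ [y Dy xy]] := P n; exists y.
    have [m ym] := ucvgX cX y.
    exists m; first by apply: ulimset_mem ym; apply: nearW => n; case: (yP n).
    by apply: ucvg_ge_cst (mdist_cvg xl ym) _; apply: nearW => n; case: (yP n).
move=> /long_unstable_exists[] /lim h; [exists 1 | exists (- 1)].
  by have [|x [D xD]] := h; [left | exists x, D; split => //; left].
by have [|x [D xD]] := h; [right | exists x, D; split => //; right].
Unshelve. all: by end_near. Qed.

Lemma deviation_le s p n : `|deviation s p n| <= n%:R / 8.
Proof.
have t1 : tau <= 1 by case: phG.
elim: n => [|n IH]; first by rewrite /deviation big_ord0 normr0 mul0r.
rewrite deviationS; apply: (le_trans (ler_normD _ _)).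
rewrite -natr1; have := theta_le (phi s (iter n (step s) p).1) (phi s (iter n (step s) p).2).
lra.
Qed.

Hypothesis e1r : e1 <= r / 4.
Hypothesis base : forall s x p y, sign s ->
  (forall n, inphase e1 (iter n (step s) (x, p))) ->
  (forall n, inphase e1 (iter n (step s) (x, y))) ->
  forall n, inphase e0 (iter n (step s) (p, proj p y)).
Hypothesis proj_wc : forall x p D, well_chained x D -> D p ->
  (forall y, D y -> d p y <= e1 + e1) -> well_chained p (proj p @` D).

(** [D] is small under all iterates in the direction [s] and has size at least [del], so
    [expansive_shrink] forces it to outgrow [e2] within [N] steps in the direction [- s]. *)
Lemma unstable_forward s del : sign s -> 0 < del -> exists N : nat, forall p D,
  well_chained p D -> (forall z, D z -> forall n, inphase e2 (iter n (step s) (p, z))) ->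
  (exists2 z, D z & del <= d p z) ->
  exists2 n, (0 < n <= N)%N & unstable s e1 e2 (phi ((- s) *+ n) p)
    ((fun z => (iter n (step (- s)) (p, z)).2) @` D).
Proof.
move=> sg del0; have [N NP] := expansive_shrink exp0 del0.
exists N => p D pD Dback [z Dz pz].
pose bad n := `[< exists2 y, D y & ~ inphase e2 (iter n (step (- s)) (p, y)) >].
have [n0 n0N bad0] : exists2 n, (n <= N)%N & bad n.
  apply: contrapT => nbad.
  have back i : inphase e0 (iter i (step s) (p, z)).
    by apply: inphase_le (Dback _ Dz i); exact: le_trans e10.
  have forw i : (i <= N)%N -> inphase e0 (iter i (step (- s)) (p, z)).
    move=> iN; apply: (inphase_le (e := e2)); first exact: le_trans e10.
    apply: contrapT => h; apply: nbad; exists i => //; apply/asboolP.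
    by exists z.
  have : d p z < del.
    case: sg back forw => -> back forw; first exact: (NP (p, z)).
    by rewrite opprK in forw; exact: (NP (p, z)).
  by rewrite ltNge pz.
have exbad : exists n, bad n by exists n0.
case: (ex_minnP exbad) => n badn nmin.
have nN : (n <= N)%N by exact: leq_trans (nmin _ bad0) n0N.
move/asboolP : badn => [w Dw nw].
have n_gt0 : (0 < n)%N.
  by case: n nmin nN nw => // _ _ []; exact: (Dback _ Dw 0).
have good i y : (i < n)%N -> D y -> inphase e2 (iter i (step (- s)) (p, y)).
  move=> ni Dy; apply: contrapT => h; have : bad i by apply/asboolP; exists y.
  by move=> /nmin; rewrite leqNgt ni.
have [wD' far DP] := first_exit (signN sg) pD n_gt0 good
  (ex_intro2 _ _ w Dw nw).
exists n; first by rewrite n_gt0.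
split => // _ [y Dy <-] m; have [ine1 back] := DP _ Dy.
(* The first [n] iterates retrace the growth; the later ones are iterates of [D] itself, which never
   leave the scale [e2]. *)
have [mn|nm] := leqP m n.
  case: m mn => [|m] mn; first exact: ine1.
  have := back _ mn; rewrite opprK => ->; apply: inphase_le e21 _; apply: good => //.
  by rewrite ltn_subrL n_gt0.
rewrite -(subnK (ltnW nm)) iterD; have := back _ (leqnn n); rewrite opprK => ->.
by rewrite subnn; apply: inphase_le e21 _; exact: Dback.
Qed.

(** A point [p] of [D] far from [K] becomes the new base point, a small continuum around it is cut
    out, and it grows again. Flowing from the new continuum in the direction [s] leads back near
    [p], then into [D]. *)
Lemma unstable_renewal (K : set X) s : compact K -> flow_invariant phi K ->
  cover_dim_le K 1 -> sign s ->
  exists L rho : R, 0 < rho /\ forall x D, unstable s e1 e2 x D ->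
    exists x' D', unstable s e1 e2 x' D' /\ forall y', D' y' ->
      (exists2 t, 1 / 2 <= t <= L & D (phi (s * t) y')) /\
      (exists2 t, 0 <= t <= L & forall k, K k -> rho <= d (phi (s * t) y') k).
Proof.
move=> cK invK dimK sg.
have e1r2 : e1 <= r / 2 by have := e1r; plra.
have [rho rho0 rhoP] := transverse_escapes cK invK dimK e1r2 e20.
have e22 : 0 < e2 / 2 by rewrite divr_gt0.
have [d0 d00 d0P] := proj_far e22.
have [d1 d10 d1P] := expansive_contraction exp0 sg e20.
(* [d0] leaves room for boundary bumping, [d1] keeps all iterates within [e2], and [rho / 2] keeps
   the piece away from [K]. *)
pose del := Num.min (Num.min d0 d1) (rho / 2).
have del0 : 0 < del by rewrite !lt_min d00 d10 divr_gt0.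
have [dd0 dd1 drho] : [/\ del <= d0, del <= d1 & del <= rho / 2].
  by split; rewrite /del !ge_min lexx ?orbT.
have [N NP] := unstable_forward sg del0.
(* The return time differs from [n] by at most [n / 8] for the deviation and 1/8 for the projection,
   hence is between 1/2 and this bound. *)
exists (2 * N%:R + 1), (rho / 2); split; first by rewrite divr_gt0.
move=> x D [xD Dback [y0 Dy0 xy0]].
have Dx : D x by case: xD.
have Dph y : D y -> inphase e1 (x, y) by move=> Dy; exact: (Dback _ Dy 0).
have [|p Dp pK] := rhoP x D xD Dph; first by exists y0.
have dp y : D y -> d p y <= e1 + e1.
  move=> /Dph[_ /= xy]; have [_ /= xp] := Dph _ Dp.
  by apply: le_trans (metric_triangle p x y) _; rewrite (metric_sym p x) lerD.
have wE := proj_wc xD Dp dp.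
(* As [x] and [y0] are at distance at least [e2], one of them is at least [e2 / 2] from [p]. *)
have [y1 Dy1 py1] : exists2 y, D y & e2 / 2 <= d p y.
  have [h|h] := leP (e2 / 2) (d p x); first by exists x.
  exists y0 => //; have := metric_triangle x p y0; rewrite (metric_sym x p); lra.
have ph4 y : D y -> inphase (r / 4) (x, y) by move=> /Dph; exact: inphase_le.
have far1 := d0P _ _ _ (ph4 _ Dp) (ph4 _ Dy1) py1.
have [D1 [wD1 D1E D1del D1far]] := boundary_bumping cX del0 wE
  (ex_intro2 _ _ y1 Dy1 erefl) (le_trans dd0 far1).
have D1back z : D1 z -> forall n, inphase e2 (iter n (step s) (p, z)).
  move=> D1z; apply: (d1P (p, z)); first exact: le_trans (D1del _ D1z) dd1.
  by have [y Dy <-] := D1E _ D1z; exact: base sg (Dback _ Dp) (Dback _ Dy).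
have [n /andP[n0 nN] st] := NP p D1 wD1 D1back D1far.
exists (phi ((- s) *+ n) p), ((fun z => (iter n (step (- s)) (p, z)).2) @` D1); split => //.
move=> _ [z D1z <-]; have [y Dy yz] := D1E _ D1z.
rewrite (iter_stepE) [snd _]/=.
set v := deviation _ _ _.
have v8 : `|v| <= n%:R / 8 by exact: deviation_le.
have th8 : `|theta p y| <= 1 / 8.
  by have := theta_le p y; have := ph_tau1 phG; lra.
have s1 : `|s| = 1 by case: sg => ->; rewrite ?normrN normr1.
have ss : s * s = 1 by case: sg => ->; rewrite ?mulrNN mulr1.
have sv : `|s * v| <= n%:R / 8 by rewrite normrM s1 mul1r.
have sth : `|s * theta p y| <= 1 / 8 by rewrite normrM s1 [X in X <= _]mul1r.
have n1 : 1 <= n%:R :> R by rewrite ler1n.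
have nNR : n%:R <= N%:R :> R by rewrite ler_nat.
move: sv sth; rewrite !ler_norml => /andP[sv1 sv2] /andP[sth1 sth2].
have to_z : phi (s * (n%:R - s * v)) (phi (- s *+ n + v) z) = z.
  rewrite flowD// (_ : - s *+ n + v + s * (n%:R - s * v) = 0) ?flow0//.
  by rewrite mulrBr mulrA ss mul1r mulNrn mulr_natr; ring.
split.
  exists (n%:R - s * v - s * theta p y).
    by apply/andP; split; lra.
  have -> : s * (n%:R - s * v - s * theta p y) = s * (n%:R - s * v) + - theta p y.
    by rewrite mulrBr mulrA ss mul1r.
  by rewrite -(flowD phiF) to_z -yz flowK.
exists (n%:R - s * v).
  by apply/andP; split; lra.
move=> k Kk; rewrite to_z.
have := pK _ Kk; have := D1del _ D1z; have := metric_triangle p z k; lra.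
Qed.

End cross_sections.

(** * Recurrence away from the invariant set *)

Theorem theorem4p7 (R : realType) (X : metricType R) (phi : R -> X -> X)
    (K : set X) :
  compact [set: X] ->
  ~ cover_dim_le [set: X] 1 ->
  is_flow phi -> regular_flow phi -> expansive phi ->
  compact K -> flow_invariant phi K ->
  cover_dim_le K 1 -> ~ cover_dim_le K 0 ->
  exists M : set X, minimal_subset phi M /\ M `&` K = set0.
Proof.
move=> cX ndim phiF reg phiE cK invK dimK _.
have [Gam [c [r [tau phG]]]] := phase_function_exists phiF cX reg.
have r0 : 0 < r by case: phG.
have [e0 e0S e0E] := expansive_inphase phiF cX phG phiE.
have [e00 _ _] := e0S.
have [eb eb0 base] := base_change phiF cX phG e00.
have [kap kap0 kapP] := proj_chained phiF cX phG.
(* [eb] serves [base_change], [kap / 2] bounds the diameter for [proj_chained], and [r / 4] serves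
   [proj_far]. *)
pose e1 := Num.min (Num.min e0 eb) (Num.min (kap / 2) (r / 4)).
have e10 : 0 < e1 by rewrite !lt_min e00 eb0 !divr_gt0.
have [e1e0 e1b e1k e1r] : [/\ e1 <= e0, e1 <= eb, e1 <= kap / 2 & e1 <= r / 4].
  by split; rewrite /e1 !ge_min lexx ?orbT.
have [e2' e2'0 e2'P] := step_small phiF cX phG 1 e10.
pose e2 := Num.min e2' e1.
have e20 : 0 < e2 by rewrite lt_min e2'0.
have [e2e2' e21] : e2 <= e2' /\ e2 <= e1 by split; rewrite /e2 ge_min lexx ?orbT.
have one_step p s : `|s| <= 1 -> inphase (Gam := Gam) e2 p ->
    inphase (Gam := Gam) e1 (step (phi := phi) (Gam := Gam) (tau := tau) s p).
  by move=> s1 [_ dp]; have [] := e2'P p s s1 (le_trans dp e2e2').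
have exp0 : expansive_scale (phi := phi) (Gam := Gam) (r := r) (tau := tau) e0 by [].
have [s [x0 [D0 [sg st0]]]] :=
  unstable_exists phiF cX phG exp0 e20 e21 e1e0 one_step ndim.
have [|| L [rho [rho0 renew]]] := unstable_renewal phiF cX phG exp0 e20 e21 e1e0 one_step
  e1r _ _ cK invK dimK sg.
- move=> s' x p y sg' hp hy; apply: (base s' x p y sg') => n; apply: inphase_le e1b _ => //.
- move=> x p D xD Dp Dk; have [] // := kapP x p D xD Dp.
  by move=> y /Dk; lra.
pose F := [set z | forall k, K k -> rho <= mdist z k].
have cF : closed F.
  apply: ucvg_closed => z l Fz zl k Kk.
  by apply: ucvg_ge_cst (mdist_cvg zl (cvg_cst k)) _; apply: nearW => n; exact: Fz.
have FK : F `&` K = set0.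
  apply/seteqP; split => // k [Fk Kk]; have := Fk k Kk.
  by rewrite mdistxx leNgt rho0.
(* After [m] renewals, orbits visit [F] with bounded gaps for time [m / 2], since each renewal adds
   at least 1/2. *)
have visits (m : nat) : exists q, forall t, 0 <= t -> t < m%:R / 2 ->
    exists2 u, `|u - t| <= L & F (phi (s * u) q).
  suff [x [D [[[_ Dx _] _ _] DP]]] : exists x D,
      unstable (phi := phi) (Gam := Gam) (tau := tau) s e1 e2 x D /\
      forall q, D q -> forall t, 0 <= t -> t < m%:R / 2 ->
        exists2 u, `|u - t| <= L & F (phi (s * u) q).
    by exists x; exact: DP.
  elim: m => [|m [x [D [st DP]]]].
    by exists x0, D0; split => // q _ t; rewrite mul0r => t0 /(le_lt_trans t0); rewrite ltxx.
  have [x' [D' [st' D'P]]] := renew _ _ st.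
  exists x', D'; split => // q /D'P[[t1 /andP[t11 t1L] Dq] [t2 /andP[t20 t2L] Fq]] t t0.
  rewrite -natr1 => tm.
  (* Before the return time [t1] the visit at [t2] serves, both times being in [[0, L]]; afterwards
     the previous continuum takes over. *)
  have [tt1|t1t] := leP t t1.
    by exists t2 => //; rewrite ler_norml; lra.
  have [||u uL Fu] := DP _ Dq (t - t1); [lra | lra |].
  exists (u + t1); first by rewrite (_ : u + t1 - t = u - (t - t1)) //; ring.
  by move: Fu; rewrite flowD// -mulrDr addrC.
have s1 : `|s| = 1 by case: sg => ->; rewrite ?normrN normr1.
have ss : s * s = 1 by case: sg => ->; rewrite ?mulrNN mulr1.
have [q qP] := choice visits.
(* Recentring at [m / 4], the middle of the window, makes the visits two-sided in the limit. *)
have [y qy] := ucvgX cX (fun m : nat => phi (s * (m%:R / 4)) (q m)).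
apply: (minimal_subset_avoiding phiF cX (F := F) (L := L) (y := y)) => // t.
have [m0 m0P] : exists m0 : nat, 4 * `|t| < m0%:R.
  by exists (Num.bound (4 * `|t|)); apply: archi_boundP; rewrite mulr_ge0.
have L0 : 0 <= L.
  have [||u uL _] := qP 1%N 0; [by [] | by rewrite mul1r invr_gt0 |].
  exact: le_trans uL.
(* For [m <= m0] the window may miss the time sought; the value [s * t] then only keeps the sequence
   bounded. *)
have /choice[v vP] : forall m : nat, exists v : R, `|v - s * t| <= L /\
    ((m0 < m)%N -> F (phi (s * v) (phi (s * (m%:R / 4)) (q m)))).
  move=> m; have [mm|mm] := leqP m m0.
    by exists (s * t); rewrite subrr normr0.
  have m4 : 4 * `|t| < m%:R by apply: lt_trans m0P _; rewrite ltr_nat.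
  have st : `|s * t| = `|t| by rewrite normrM s1 mul1r.
  have /andP[st1 st2] : - `|t| <= s * t <= `|t| by rewrite -ler_norml st.
  have [||u uL Fu] := qP m (s * t + m%:R / 4); [lra | lra |].
  exists (u - m%:R / 4); split.
    by rewrite (_ : u - m%:R / 4 - s * t = u - (s * t + m%:R / 4)) //; ring.
  by move=> _; rewrite flowD// -mulrDr addrC subrK.
have [w wL vw] := ucvg_real (u := fun m => v m - s * t) (fun m => proj1 (vP m)).
exists (s * (w + s * t)).
  by rewrite mulrDr mulrA ss mul1r addrK normrM s1 mul1r.
have vw' : v @ uoo --> w + s * t.
  rewrite (_ : v = fun m => (v m - s * t) + s * t); last by apply/funext => m; rewrite subrK.
  by apply: cvgD => //; exact: cvg_cst.
have svw : (fun m => s * v m) @ uoo --> s * (w + s * t) by apply: cvgM => //; exact: cvg_cst.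
apply: closed_ucvg cF _ (flow_cvg phiF svw qy).
by near=> m; apply: (vP m).2; near: m; exact: uoo_ge.
Unshelve. all: by end_near. Qed.
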